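(* Let $n\ge k\ge 2$ be integers. There exists a ${}^2\mathrm{H}(n;k)$ if and only if $k\ge 3$ and $nk\not\equiv 1\pmod 4$.
   Context: For positive integers $m,n,s,k,\lambda,t$ with $t$ dividing $\frac{2nk}{\lambda}$, let $v=\frac{2nk}{\lambda}+t$ and $J$ the subgroup of $\mathbb{Z}_v$ of order $t$. A ${}^\lambda\mathrm{H}_t(m,n;s,k)$ is an $m\times n$ partially filled array with entries in $\mathbb{Z}_v$ such that: (a) each row has exactly $s$ and each column exactly $k$ filled cells; (b) the multiset $\{\pm x: x$ an entry of a filled cell$\}$ contains each element of $\mathbb{Z}_v\setminus J$ exactly $\lambda$ times and no element of $J$; (c) every row and every column sums to $0$ in $\mathbb{Z}_v$. When $t=1$ the subscript is omitted, and when $m=n$ (hence $s=k$) the array is denoted ${}^\lambda\mathrm{H}_t(n;k)$. Thus ${}^2\mathrm{H}(n;k)$ is an $n\times n$ array over $\mathbb{Z}_{nk+1}$ with $k$ filled cells in each row and column. *)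

(* Defs.v *)
From mathcomp Require Import all_boot all_order all_algebra.
Set Implicit Arguments. Unset Strict Implicit. Unset Printing Implicit Defensive.
Import GRing.Theory.
Local Open Scope ring_scope.

Definition hv (lam t n k : nat) : nat := ((2 * n * k) %/ lam + t)%N.

(* A partially filled m x n array over Z_v: None = empty cell. *)
Definition parray (m n v : nat) := 'I_m -> 'I_n -> option 'Z_v.

(* entry value (0 for empty cells, which do not contribute to sums) *)
Definition pval (v : nat) (c : option 'Z_v) : 'Z_v := odflt 0 c.

(* membership in the subgroup J of Z_v of order t: multiples of v/t *)
Definition inJ (v t : nat) (x : 'Z_v) : bool := ((v %/ t) %| x)%N.

(* multiplicity of x in the multiset {+-e : e an entry of a filled cell} *)
Definition pm_mult (m n v : nat) (A : parray m n v) (x : 'Z_v) : nat :=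
  (#|[set ij : 'I_m * 'I_n | A ij.1 ij.2 == Some x]|
   + #|[set ij : 'I_m * 'I_n | A ij.1 ij.2 == Some (- x)]|)%N.

Definition is_LH (lam t m n s k : nat) (A : parray m n (hv lam t n k)) : Prop :=
  [/\ forall i : 'I_m, #|[set j | A i j != None]| = s,
      forall j : 'I_n, #|[set i | A i j != None]| = k,
      forall x : 'Z_(hv lam t n k),
        @pm_mult m n _ A x = (if @inJ _ t x then 0 else lam)%N,
      forall i : 'I_m, \sum_(j < n) pval (A i j) = 0
    & forall j : 'I_n, \sum_(i < m) pval (A i j) = 0].

Definition exists_LH (lam t m n s k : nat) : Prop :=
  [/\ (0 < lam)%N, (0 < t)%N, (lam %| 2 * n * k)%N, (t %| (2 * n * k) %/ lam)%N
    & exists A : parray m n (hv lam t n k), @is_LH lam t m n s k A].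

(* ^2 H(n;k): lambda = 2, t = 1, m = n, s = k; entries in Z_{nk+1} *)
Definition exists_2H (n k : nat) : Prop := exists_LH 2 1 n n k k.

(* Main.v *)
Require Import Defs.
From mathcomp Require Import all_boot all_order all_algebra.
From mathcomp Require Import zify ring.
Set Implicit Arguments. Unset Strict Implicit. Unset Printing Implicit Defensive.
Import GRing.Theory Num.Theory.
Local Open Scope ring_scope.

(** Write [v = nk + 1]. If [k = 2], the entry [a] of a cell forces [-a] in its row and in its
    column, hence three occurrences of [{a, -a}]. If [nk = 1 mod 4], the entries sum to an even
    number, whereas counting classes shows that [v/2] of them, an odd number, are odd.

    The arrays are circulant: the cells of a cyclic diagonal carry a piecewise linear function
    of the row. There are [nk] filled cells, so it is enough that every class [{y, -y}] occurs
    at least twice. Most diagonals come from doubling: an array [B] whose row sums are invariant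
    under a cyclic shift of the rows is completed by the shift of [-B], which cancels all row
    and column sums and uses each class of [B] once more. Pairs of diagonals with entries
    [a + i], [-(b + i)] have constant row sums, so doubling adds [4] to [k] at the cost of two
    free intervals of classes. This settles [k = 0 mod 4], and [k = 2 mod 4] after doubling one
    triple of diagonals. For odd [k] the remaining three, five or seven diagonals are

    - [n] even: two translates of a zigzag permutation of [0, ..., n - 1] and its consecutive
      sums ([k = 3 mod 4]), or a variant with two further diagonals [t], [-t] ([k = 1 mod 4]);
    - [n = 3 mod 4]: a symmetric five-diagonal array whose main diagonal surrounds [v/2];
    - [n = 1 mod 4], [k = 3]: a three-diagonal array in which one diagonal runs through [v/2];
    - [n = 1 mod 4], [k >= 7]: an integer array with one entry [0], where [v/2] is added to the
      four cells of a rectangle with absolute values [0], [x], [v/4], [v/2 - x]. *)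

(** * Circulant arrays given by their diagonals *)

(** A pair [(o, f)] stands for the cyclic diagonal of the cells in row [i] and column [i + o] modulo
    [n], with entry [f i]. Entries stay integers, so that sums and classes are matters of linear
    arithmetic; only [lookup] reduces them modulo [v]. *)
Definition slot := (nat * (nat -> int))%type.

(** For arguments below [n] this is [j - o] modulo [n]: the row in which the diagonal of offset [o]
    meets column [j], and likewise the offset of the diagonal through row [o] and column [j]. The
    conditional form keeps it within reach of [lia]. *)
Definition back (n o j : nat) : nat := (if o <= j then j - o else j + n - o)%N.

Lemma back_lt n o j : (j < n)%N -> (back n o j < n)%N.
Proof. by rewrite /back; case: (leqP o j) => *; lia. Qed.

Definition hit (v : nat) (e y : int) : bool := (v%:Z %| e - y)%Z.

Definition slot_count (n v : nat) (f : nat -> int) (y : int) : nat :=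
  (\sum_(i < n) (hit v (f i) y + hit v (f i) (- y)))%N.

Definition count_class (n v : nat) (L : seq slot) (y : int) : nat :=
  (\sum_(p <- L) slot_count n v p.2 y)%N.

Definition row_sum (L : seq slot) (i : nat) : int := \sum_(p <- L) p.2 i.

Definition col_sum (n : nat) (L : seq slot) (j : nat) : int :=
  \sum_(p <- L) p.2 (back n p.1 j).

Lemma intr_Zp_eq0 (v : nat) (a : int) : (1 < v)%N ->
  ((a%:~R : 'Z_v) == 0) = (v%:Z %| a)%Z.
Proof.
move=> v1.
have natE (m : nat) : ((m%:R : 'Z_v) == 0) = (v %| m)%N.
  by rewrite -val_eqE /= val_Zp_nat // /dvdn.
by case: a => m; rewrite ?NegzE ?mulrNz ?oppr_eq0 ?rpredN -?pmulrn natE.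
Qed.

Lemma intr_Zp_eq (v : nat) (a : int) (x : 'Z_v) : (1 < v)%N ->
  ((a%:~R : 'Z_v) == x) = hit v a (x : nat)%:Z.
Proof.
move=> v1; rewrite /hit -intr_Zp_eq0 // rmorphB /= subr_eq0.
by rewrite -[x in LHS]natr_Zp -pmulrn.
Qed.

Definition lookup (v : nat) (L : seq slot) (i d : nat) : option 'Z_v :=
  omap (fun p : slot => (p.2 i)%:~R) (ohead [seq p <- L | p.1 == d]).

Lemma eq_big_all (V : nmodType) (T : Type) (a : pred T) (F G : T -> V) (s : seq T) :
  all a s -> (forall p, a p -> F p = G p) ->
  \sum_(p <- s) F p = \sum_(p <- s) G p.
Proof.
move=> sa FG; elim: s sa => [|p s IH] /=; first by rewrite !big_nil.
by case/andP=> ap sa; rewrite !big_cons IH // FG.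
Qed.

(** [F] is arbitrary so that entry sums, numbers of filled cells and multiplicities are all
    instances. Distinct offsets leave at most one term in the sum. *)
Lemma lookup_sum (V : nmodType) (v : nat) (L : seq slot) (F : option 'Z_v -> V)
    (i d : nat) : F None = 0 -> uniq (map fst L) ->
  F (lookup v L i d) = \sum_(p <- L | p.1 == d) F (Some (p.2 i)%:~R).
Proof.
move=> F0; rewrite /lookup; elim: L => [|p L IH] /=; first by rewrite big_nil.
case/andP=> pL uL; rewrite big_cons; case: eqP => [pd|_] /=; last exact: IH.
have -> : \sum_(q <- L | q.1 == d) F (Some (q.2 i)%:~R) = 0; last by rewrite addr0.
rewrite pd in pL; elim: L pL {IH uL} => [|q s IH] /=; first by rewrite big_nil.
by rewrite inE negb_or big_cons eq_sym => /andP[/negbTE-> /IH].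
Qed.

Definition slot_array (n v : nat) (L : seq slot) : parray n n v :=
  fun i j => lookup v L i (back n i j).

Section SlotArray.
Variables (n v : nat) (L : seq slot).
Hypothesis L_uniq : uniq (map fst L).
Hypothesis L_lt : all (fun p : slot => p.1 < n)%N L.
Let A := @slot_array n v L.

Lemma slot_array_row (V : nmodType) (F : option 'Z_v -> V) (i : 'I_n) :
  F None = 0 -> \sum_(j < n) F (A i j) = \sum_(p <- L) F (Some (p.2 i)%:~R).
Proof.
move=> F0; have ltin := ltn_ord i.
under eq_bigr do rewrite /A /slot_array lookup_sum //.
rewrite (exchange_big_dep xpredT) //=; apply: (eq_big_all L_lt) => p pn.
have ltj : ((if i + p.1 < n then i + p.1 else i + p.1 - n) < n)%N.
  by case: (ltnP (i + p.1) n) => *; lia.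
rewrite (big_pred1 (Ordinal ltj)) // => j; rewrite /= -val_eqE /= /back.
have ltj' := ltn_ord j; apply/eqP/eqP; case: (leqP i j) => ?; case: (ltnP (i + p.1) n) => ?; lia.
Qed.

Lemma slot_array_col (V : nmodType) (F : option 'Z_v -> V) (j : 'I_n) :
  F None = 0 ->
  \sum_(i < n) F (A i j) = \sum_(p <- L) F (Some (p.2 (back n p.1 j))%:~R).
Proof.
move=> F0; have ltjn := ltn_ord j.
under eq_bigr do rewrite /A /slot_array lookup_sum //.
rewrite (exchange_big_dep xpredT) //=; apply: (eq_big_all L_lt) => p pn.
rewrite (big_pred1 (Ordinal (back_lt p.1 ltjn))) // => i; rewrite /= -val_eqE /= /back.
have lti' := ltn_ord i; apply/eqP/eqP; case: (leqP i j) => ?; case: (leqP p.1 j) => ?; lia.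
Qed.

End SlotArray.

Lemma hitN v e y : hit v e (- y) = hit v (- e) y.
Proof. by rewrite /hit opprK -opprD rpredN. Qed.

Lemma intr_Zp_eqN (v : nat) (a : int) (x : 'Z_v) : (1 < v)%N ->
  ((a%:~R : 'Z_v) == - x) = hit v a (- (x : nat)%:Z).
Proof.
move=> v1; rewrite /hit opprK -intr_Zp_eq0 // rmorphD /= addr_eq0.
by rewrite -[x in LHS]natr_Zp -pmulrn.
Qed.

Lemma sum_nat_seq_const (T : Type) (c : nat) (s : seq T) :
  \sum_(p <- s) c = (c * size s)%N.
Proof.
elim: s => [|p s IH]; first by rewrite big_nil muln0.
by rewrite big_cons IH /= mulnS.
Qed.

Lemma card_pairs (m n : nat) (P : pred ('I_m * 'I_n)) :
  #|[set ij | P ij]| = (\sum_(i < m) \sum_(j < n) P (i, j))%N.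
Proof.
rewrite -sum1dep_card big_mkcond (pair_big xpredT xpredT (fun i j => nat_of_bool (P (i, j)))).
by apply: eq_bigr => -[i j] _ /=; case: (P _).
Qed.

Lemma pm_multE (m n v : nat) (A : parray m n v) (x : 'Z_v) :
  pm_mult A x =
  (\sum_(i < m) \sum_(j < n) ((A i j == Some x) + (A i j == Some (- x))))%N.
Proof.
rewrite /pm_mult !card_pairs -big_split; apply: eq_bigr => i _.
by rewrite -big_split.
Qed.

Lemma sum_pm_cell (v : nat) (c : option 'Z_v) :
  (\sum_x ((c == Some x) + (c == Some (- x))) = 2 * isSome c)%N.
Proof.
case: c => [a|]; last by rewrite big1.
have one (b : 'Z_v) : (\sum_x (b == x) = 1)%N.
  by rewrite (bigD1 b) //= eqxx big1 // => x; rewrite eq_sym => /negbTE->.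
rewrite big_split /= [X in (_ + X)%N](reindex_inj oppr_inj) /=.
by under [X in (_ + X)%N]eq_bigr do rewrite opprK; rewrite !one.
Qed.

(** Lower bounds on the multiplicities suffice: they add up to [2 * (n * k)], which is exactly two
    for each of the [v - 1] nonzero elements, so no bound can be strict and [0] does not occur. *)
Lemma exists_2H_of_slots (n k : nat) (L : seq slot) :
  (0 < n)%N -> (0 < k)%N -> size L = k -> uniq (map fst L) ->
  all (fun p : slot => p.1 < n)%N L ->
  (forall i, (i < n)%N -> ((n * k).+1%:Z %| row_sum L i)%Z) ->
  (forall j, (j < n)%N -> ((n * k).+1%:Z %| col_sum n L j)%Z) ->
  (forall y : nat, (0 < y)%N -> (2 * y <= (n * k).+1)%N ->
     (2 <= count_class n (n * k).+1 L y%:Z)%N) ->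
  exists_2H n k.
Proof.
move=> n0 k0 sL uL ltL rowL colL cov.
split=> //; rewrite ?dvd1n -?mulnA ?dvdn_mulr //.
have hvE : hv 2 1 n k = (n * k).+1 by rewrite /hv -mulnA mulKn // addn1.
rewrite -hvE in rowL colL cov; set v := hv 2 1 n k in rowL colL cov *.
have v1 : (1 < v)%N by rewrite /v hvE ltnS muln_gt0 n0.
have vE : (Zp_trunc v).+2 = v by exact: Zp_cast.
pose A := @slot_array n v L; exists A.
have row := @slot_array_row n v L uL ltL; have col := @slot_array_col n v L uL ltL.
pose pm (x : 'Z_v) (c : option 'Z_v) : nat := ((c == Some x) + (c == Some (- x)))%N.
have pmE x : pm_mult A x = (\sum_(i < n) \sum_(j < n) pm x (A i j))%N.
  exact: pm_multE.
have pm_count x : pm_mult A x = count_class n v L (x : nat)%:Z.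
  rewrite pmE; under eq_bigr do rewrite row //.
  rewrite exchange_big /count_class; apply: eq_bigr => p _; apply: eq_bigr => i _.
  by rewrite /pm !(inj_eq Some_inj) intr_Zp_eq // intr_Zp_eqN.
have pm_total : (\sum_(x : 'Z_v) pm_mult A x = 2 * (n * k))%N.
  under eq_bigr do rewrite pmE.
  rewrite exchange_big /=; under eq_bigr do rewrite exchange_big /=.
  under eq_bigr do under eq_bigr => j _ do rewrite /pm sum_pm_cell.
  under eq_bigr do rewrite (row nat (fun c => 2 * isSome c)%N) //= sum_nat_seq_const sL.
  rewrite sum_nat_const card_ord.
  lia.
have pmP (x : 'Z_v) : pm_mult A x = (if x == 0%R then 0 else 2)%N.
  have pm_ge (y : 'Z_v) : ((if y == 0%R then 0 else 2) <= pm_mult A y ?= iff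
      ((if y == 0%R then 0 else 2) == pm_mult A y))%N.
    apply: leqif_eq; case: eqP => // /eqP y0.
    have y_gt0 : (0 < y)%N by rewrite lt0n.
    have y_lt : (y < v)%N by rewrite -[X in (_ < X)%N]vE.
    have [le2|gt2] := leqP (2 * y) v; first by rewrite pm_count cov.
    (* Multiplicities are invariant under negation, so an element above [v / 2] is replaced by its
       opposite. *)
    have <- : pm_mult A (- y) = pm_mult A y by rewrite /pm_mult opprK addnC.
    have yN : (- y : 'Z_v) = (v - y)%N :> nat.
      by rewrite /= modn_small; lia.
    by rewrite pm_count yN cov //; lia.
  (* Equality of the totals forces equality in every term. *)
  have [_] := leqif_sum (fun y (_ : xpredT y) => pm_ge y).
  rewrite pm_total (bigD1 0) //= add0n.
  under eq_bigr => y y0 do rewrite (negbTE y0).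
  rewrite sum_nat_const cardC1 card_ord.
  have -> : ((Zp_trunc v).+2.-1 * 2 = 2 * (n * k))%N by rewrite vE /v hvE mulnC.
  rewrite eqxx.
  by move/esym/forallP/(_ x)/eqP.
split.
- move=> i; rewrite -sum1dep_card big_mkcond (row nat (fun c => if c != None then 1 else 0)%N) //=.
  by rewrite sum_nat_seq_const mul1n.
- move=> j; rewrite -sum1dep_card big_mkcond (col nat (fun c => if c != None then 1 else 0)%N) //=.
  by rewrite sum_nat_seq_const mul1n.
- move=> x; rewrite /inJ divn1 pmP -val_eqE /=.
  have x_lt : (x < v)%N by rewrite -[X in (_ < X)%N]vE.
  have [->|x0] := posnP x; first by rewrite dvdn0.
  by rewrite gtnNdvd.
- move=> i; rewrite row //= -rmorph_sum /=; apply/eqP; rewrite intr_Zp_eq0 //.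
  exact: rowL.
- move=> j; rewrite col //= -rmorph_sum /=; apply/eqP; rewrite intr_Zp_eq0 //.
  exact: colL.
Qed.

Lemma count_class_cat n v L1 L2 y :
  count_class n v (L1 ++ L2) y = (count_class n v L1 y + count_class n v L2 y)%N.
Proof. by rewrite /count_class big_cat. Qed.

Lemma count_class_cons n v p L y :
  count_class n v (p :: L) y = (slot_count n v p.2 y + count_class n v L y)%N.
Proof. by rewrite /count_class big_cons. Qed.

Lemma count_class_nil n v y : count_class n v [::] y = 0%N.
Proof. by rewrite /count_class big_nil. Qed.

(* Weaker than congruence up to sign, but decidable by [lia] when [v] is nonlinear in [n], [k]. *)
Definition same_class (v : nat) (e y : int) : bool :=
  [|| e == y, e == - y, e == y - v%:Z | e == v%:Z - y].

Lemma same_class_hit v e y : same_class v e y -> hit v e y || hit v e (- y).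
Proof.
rewrite /hit => /or4P[] /eqP->; apply/orP.
- by left; rewrite subrr dvdz0.
- by right; rewrite subrr dvdz0.
- by left; rewrite addrAC subrr add0r rpredN dvdzz.
- by right; rewrite opprK subrK dvdzz.
Qed.

Lemma slot_count_ge1 n v f y i : (i < n)%N -> same_class v (f i) y ->
  (1 <= slot_count n v f y)%N.
Proof.
move=> ltin /same_class_hit hi; rewrite /slot_count (bigD1 (Ordinal ltin)) //=.
by move: hi; case: hit; case: hit.
Qed.

Lemma slot_count_ge2 n v f y i j : (i < n)%N -> (j < n)%N -> i != j ->
  same_class v (f i) y -> same_class v (f j) y -> (2 <= slot_count n v f y)%N.
Proof.
move=> ltin ltjn nij /same_class_hit hi /same_class_hit hj.
rewrite /slot_count (bigD1 (Ordinal ltin)) //= (bigD1 (Ordinal ltjn)) /=; last first.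
  by rewrite -val_eqE /= eq_sym.
by move: hi hj; do 4 case: hit.
Qed.

(* An entry [v/2] is its own opposite, hence is counted twice. *)
Lemma slot_count_half n v f (y : nat) i : (i < n)%N -> (2 * y)%N = v ->
  same_class v (f i) y -> (2 <= slot_count n v f y)%N.
Proof.
move=> ltin vE /same_class_hit hi.
have hNi : hit v (f i) (- y%:Z) = hit v (f i) y%:Z.
  rewrite /hit opprK; have -> : f i + y%:Z = f i - y%:Z + v%:Z by lia.
  by rewrite rpredDr // dvdzz.
rewrite /slot_count (bigD1 (Ordinal ltin)) //= hNi.
by move: hi; rewrite hNi orbb => ->.
Qed.

(** * Doubling, and pairs of diagonals with constant row sums *)

Definition double (n g : nat) (B : seq slot) : seq slot :=
  B ++ [seq ((p.1 + g)%N, fun i => - p.2 ((i + g) %% n)%N) | p <- B].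

Lemma row_sum_cat L1 L2 i : row_sum (L1 ++ L2) i = row_sum L1 i + row_sum L2 i.
Proof. exact: big_cat. Qed.

Lemma col_sum_cat n L1 L2 j : col_sum n (L1 ++ L2) j = col_sum n L1 j + col_sum n L2 j.
Proof. exact: big_cat. Qed.

Lemma row_sum_double n g B i :
  row_sum B ((i + g) %% n)%N = row_sum B i -> row_sum (double n g B) i = 0.
Proof.
by move=> eqB; rewrite row_sum_cat -eqB /row_sum big_map sumrN subrr.
Qed.

Lemma back_add n o g j : (o + g < n)%N -> (j < n)%N ->
  ((back n (o + g) j + g) %% n)%N = back n o j.
Proof.
move=> og jn; rewrite /back; case: (leqP (o + g) j) => ?; case: (leqP o j) => ?; try lia.
- by rewrite modn_small; lia.
- have -> : (j + n - (o + g) + g = j - o + n)%N by lia.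
  by rewrite modnDr modn_small; lia.
- by rewrite modn_small; lia.
Qed.

(** The copy of an entry stays in its column, [g] rows further up, with the opposite sign. Columns
    therefore cancel for every [B]; only the rows need an invariance. *)
Lemma col_sum_double n g B j : all (fun p : slot => p.1 + g < n)%N B -> (j < n)%N ->
  col_sum n (double n g B) j = 0.
Proof.
move=> ltB jn; rewrite col_sum_cat /col_sum big_map sumrN.
rewrite [X in _ - X](_ : _ = \sum_(p <- B) p.2 (back n p.1 j)) ?subrr //.
by apply: (eq_big_all ltB) => p ltp /=; rewrite back_add.
Qed.

Lemma slot_countN n v f y : slot_count n v (fun i => - f i) y = slot_count n v f y.
Proof.
apply: eq_bigr => i _.
by rewrite -hitN -[X in (_ + hit _ _ X)%N]opprK addnC hitN opprK hitN opprK.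
Qed.

Lemma slot_count_shift n v g f y :
  slot_count n v (fun i => - f ((i + g) %% n)%N) y = slot_count n v f y.
Proof.
rewrite (slot_countN n v (fun i => f ((i + g) %% n)%N)).
case: n => [|n]; first by rewrite /slot_count !big_ord0.
pose s (i : 'I_n.+1) : 'I_n.+1 := inord ((i + g) %% n.+1).
have sE i : s i = ((i + g) %% n.+1)%N :> nat by rewrite inordK // ltn_pmod.
have s_inj : injective s.
  move=> i j /(congr1 (@nat_of_ord _)); rewrite !sE => /eqP.
  by rewrite eqn_modDr !modn_small // => /eqP/val_inj.
by rewrite /slot_count [RHS](reindex_inj s_inj) /=; apply: eq_bigr => i _; rewrite sE.
Qed.

Lemma count_class_double n v g B y :
  count_class n v (double n g B) y = (2 * count_class n v B y)%N.
Proof.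
rewrite count_class_cat mul2n -addnn; congr (_ + _)%N.
rewrite /count_class big_map; apply: eq_bigr => p _; exact: slot_count_shift.
Qed.

(** [L] occupies the offsets below [k0], [B] the next [m], and the copy of [B] the [m] offsets from
    [k0 + g] on; [m <= g] and [k0 + m + g <= n] keep these apart. A class found once in [B] is
    already settled. *)
Lemma exists_2H_double (n k k0 m g : nat) (L B : seq slot) :
  (0 < n)%N -> (0 < k)%N -> k = (k0 + 2 * m)%N -> (m <= g)%N -> (k0 + m + g <= n)%N ->
  map fst L = iota 0 k0 -> map fst B = iota k0 m ->
  (forall i, (i < n)%N -> ((n * k).+1%:Z %| row_sum L i)%Z) ->
  (forall j, (j < n)%N -> ((n * k).+1%:Z %| col_sum n L j)%Z) ->
  (forall i, (i < n)%N -> row_sum B ((i + g) %% n)%N = row_sum B i) ->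
  (forall y : nat, (0 < y)%N -> (2 * y <= (n * k).+1)%N ->
     (2 <= count_class n (n * k).+1 L y%:Z + 2 * count_class n (n * k).+1 B y%:Z)%N) ->
  exists_2H n k.
Proof.
move=> n0 k_gt0 kE mg gn oL oB rowL colL rowB cov.
have oLB : map fst (L ++ double n g B) = iota 0 (k0 + m) ++ iota (k0 + g) m.
  rewrite !map_cat oL oB catA -iotaD; congr (_ ++ _).
  rewrite -map_comp (eq_map (g := addn g \o fst)) => [|p]; last by rewrite /= addnC.
  by rewrite map_comp oB -iotaDl addnC.
have ltB : all (fun p : slot => p.1 + g < n)%N B.
  suff : all (fun o => o + g < n)%N (map fst B) by rewrite all_map.
  by rewrite oB; apply/allP => o; rewrite mem_iota; lia.
apply: (@exists_2H_of_slots _ _ (L ++ double n g B)) => //.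
- by rewrite -(size_map fst) oLB size_cat !size_iota; lia.
- rewrite oLB cat_uniq !iota_uniq andbT /=; apply/hasPn => o.
  by rewrite !mem_iota; lia.
- suff : all (fun o => o < n)%N (map fst (L ++ double n g B)) by rewrite all_map.
  rewrite oLB all_cat.
  by apply/andP; split; apply/allP => o; rewrite mem_iota; lia.
- by move=> i ltin; rewrite row_sum_cat row_sum_double ?addr0; auto.
- by move=> j ltjn; rewrite col_sum_cat col_sum_double ?addr0; auto.
- by move=> y y0 yv; rewrite count_class_cat count_class_double; auto.
Qed.

(** The classes covered are the intervals from [a + 1] to [a + m * n] and from [b + 1] to
    [b + m * n]. Each pair has sum [a - b] in every row, so any shift [g] is admissible for
    doubling. *)
Definition pairs (n d m a b : nat) : seq slot :=
  flatten [seq [:: ((d + 2 * c)%N, fun i => (a + c * n + i).+1%:Z);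
                   ((d + 2 * c).+1, fun i => - (b + c * n + i).+1%:Z)] | c <- iota 0 m].

Lemma pairs_offsets n d m a b : map fst (pairs n d m a b) = iota d (2 * m).
Proof.
rewrite /pairs; elim: m => [|m IH]; first by rewrite muln0.
by rewrite -[m.+1]addn1 mulnDr muln1 (iotaD 0) (iotaD d (2 * m)) map_cat flatten_cat
  map_cat IH /= add0n.
Qed.

Lemma row_sum_pairs n d m a b i j :
  row_sum (pairs n d m a b) i = row_sum (pairs n d m a b) j.
Proof.
rewrite /row_sum /pairs; elim: (iota 0 m) => [|c r IH]; first by rewrite !big_nil.
rewrite /= !big_cons IH /=; lia.
Qed.

Lemma count_class_pairs n v d m a b y : (0 < n)%N ->
  (a < y <= a + m * n)%N || (b < y <= b + m * n)%N ->
  (1 <= count_class n v (pairs n d m a b) y%:Z)%N.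
Proof.
move=> n0 yab.
have [c [i [cm ltin yE]]] : exists c i, [/\ (c < m)%N, (i < n)%N &
    y = (a + c * n + i).+1 \/ y = (b + c * n + i).+1].
  have split_y z : (z < y <= z + m * n)%N ->
      exists c i, [/\ (c < m)%N, (i < n)%N & y = (z + c * n + i).+1].
    move=> zy; exists ((y - z).-1 %/ n)%N, ((y - z).-1 %% n)%N.
    rewrite ltn_divLR // ltn_pmod // -addnA -divn_eq; split=> //; lia.
  by case/orP: yab => /split_y[c [i [? ? ?]]]; exists c, i; split; auto.
have : c \in iota 0 m by rewrite mem_iota.
rewrite /pairs; elim: (iota 0 m) => [//|c' r IH].
rewrite inE /= !count_class_cons /= => /orP[/eqP<-|/IH hr].
  2: by rewrite addnA (leq_trans hr) // leq_addl.
case: yE => yE.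
- have := @slot_count_ge1 n v (fun i => (a + c * n + i).+1%:Z) y i ltin.
  by rewrite /same_class; lia.
- have := @slot_count_ge1 n v (fun i => - (b + c * n + i).+1%:Z) y i ltin.
  by rewrite /same_class; lia.
Qed.

Lemma slot_count_back n v o f y : (o < n)%N ->
  slot_count n v (fun i => f (back n o i)) y = slot_count n v f y.
Proof.
case: n => [|n] on; first by rewrite /slot_count !big_ord0.
pose s (i : 'I_n.+1) : 'I_n.+1 := inord (back n.+1 o i).
have sE i : s i = back n.+1 o i :> nat by rewrite inordK // back_lt.
have s_inj : injective s.
  move=> i j /(congr1 (@nat_of_ord _)); rewrite !sE /back => ij; apply: val_inj => /=.
  have := ltn_ord i; have := ltn_ord j.
  by move: ij; case: (leqP o i) => ?; case: (leqP o j) => ?; lia.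
by rewrite /slot_count [RHS](reindex_inj s_inj) /=; apply: eq_bigr => i _; rewrite sE.
Qed.

Lemma row_sum_nil i : row_sum [::] i = 0.
Proof. exact: big_nil. Qed.

Lemma col_sum_nil n i : col_sum n [::] i = 0.
Proof. exact: big_nil. Qed.

Lemma row_sum_cons p L i : row_sum (p :: L) i = p.2 i + row_sum L i.
Proof. exact: big_cons. Qed.

Lemma col_sum_cons n p L j : col_sum n (p :: L) j = p.2 (back n p.1 j) + col_sum n L j.
Proof. exact: big_cons. Qed.

Lemma back0 n j : back n 0 j = j.
Proof. by rewrite /back /= subn0. Qed.

Lemma back1S n i : back n 1 i.+1 = i.
Proof. by rewrite /back subn1. Qed.

Lemma backS n o j : (o.+1 < n)%N -> (j < n)%N -> back n o.+1 j = back n 1 (back n o j).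
Proof.
move=> on jn; rewrite /back; case: (leqP o j) => ?; case: (leqP o.+1 j) => ?.
all: by case: leqP; lia.
Qed.

Definition interleave (E O : nat -> int) (x : nat) : int :=
  if odd x then O x./2 else E x./2.

Lemma interleave_even E O i : interleave E O (2 * i) = E i.
Proof. by rewrite /interleave mul2n odd_double doubleK. Qed.

Lemma interleave_odd E O i : interleave E O (2 * i).+1 = O i.
Proof. by rewrite /interleave mul2n /= odd_double /= uphalf_double. Qed.

Lemma slot_count_at n v f y i e : (i < n)%N -> f i = e -> same_class v e y ->
  (1 <= slot_count n v f y)%N.
Proof. by move=> ltin <-; exact: slot_count_ge1. Qed.

Lemma slot_count_at2 n v f y i j e e' : (i < n)%N -> (j < n)%N -> i != j ->
  f i = e -> f j = e' -> same_class v e y -> same_class v e' y ->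
  (2 <= slot_count n v f y)%N.
Proof. by move=> ? ? ? <- <-; exact: slot_count_ge2. Qed.

(** * Even [k] *)

(** Only doubled pairs are needed: the two intervals join to [1, ..., 2 * j * n], and
    [v = 4 * j * n + 1]. *)
Lemma exists_2H_k0 n j : (0 < j)%N -> (4 * j <= n)%N -> exists_2H n (4 * j).
Proof.
move=> j0 jn.
apply: (@exists_2H_double n _ 0 (2 * j) (2 * j) [::] (pairs n 0 j 0 (j * n))); try lia.
- by [].
- exact: pairs_offsets.
- by move=> i _; rewrite row_sum_nil dvdz0.
- by move=> i _; rewrite col_sum_nil dvdz0.
- by move=> i _; exact: row_sum_pairs.
move=> y y0 yv; rewrite count_class_nil.
suff : (1 <= count_class n (n * (4 * j)).+1 (pairs n 0 j 0 (j * n)) y%:Z)%N by lia.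
apply: count_class_pairs; nia.
Qed.

(** With [v = 2 * N + 1], the diagonals [t0] and [t1] take the lowest [2 * n] classes, [t2] the
    highest [n], and the pairs those between. The shift is [n./2], the largest that leaves room for
    the copy, and the triple has to be invariant under it only. *)
Lemma exists_2H_triples (n j : nat) (t0 t1 t2 : nat -> int)
    (N := (3 * n + 2 * (j * n))%N) :
  (6 + 4 * j <= n)%N ->
  (forall i, (i < n)%N -> let i' := ((i + n./2) %% n)%N in
     t0 i' + t1 i' + t2 i' = t0 i + t1 i + t2 i) ->
  (forall w, (w < n)%N -> exists2 i, (i < n)%N & t0 i = w.+1%:Z) ->
  (forall w, (w < n)%N -> exists2 i, (i < n)%N & t1 i = (n + w.+1)%N%:Z) ->
  (forall w, (w < n)%N -> exists2 i, (i < n)%N &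
     same_class (2 * N).+1 (t2 i) (N - w)%N%:Z) ->
  exists_2H n (6 + 4 * j).
Proof.
move=> jn inv cov0 cov1 cov2.
have vE : (n * (6 + 4 * j)).+1 = (2 * N).+1 by rewrite /N; lia.
pose P := pairs n 3 j (2 * n) (2 * n + j * n).
apply: (@exists_2H_double n _ 0 (3 + 2 * j) n./2 [::]
  ([:: (0%N, t0); (1%N, t1); (2, t2)] ++ P)); rewrite ?vE; try lia.
- by [].
- by rewrite map_cat pairs_offsets iotaD.
- by move=> i _; rewrite row_sum_nil dvdz0.
- by move=> i _; rewrite col_sum_nil dvdz0.
- move=> i ltin; rewrite !row_sum_cat (row_sum_pairs _ _ _ _ _ _ i); congr (_ + _).
  by rewrite !row_sum_cons !row_sum_nil /= !addr0 !addrA inv.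
set v := (2 * N).+1 => y y0 yv; rewrite count_class_nil count_class_cat.
rewrite !count_class_cons count_class_nil /=.
have [y1|y1] := leqP y n.
  have [i ltin ti] := cov0 y.-1 ltac:(lia).
  by have := @slot_count_ge1 n v t0 y i ltin; rewrite /same_class; lia.
have [y2|y2] := leqP y (2 * n).
  have [i ltin ti] := cov1 (y - n).-1 ltac:(lia).
  by have := @slot_count_ge1 n v t1 y i ltin; rewrite /same_class; lia.
have [y3|y3] := leqP y (N - n).
  suff : (1 <= count_class n v P y%:Z)%N by lia.
  by apply: count_class_pairs; lia.
have [i ltin ti] := cov2 (N - y)%N ltac:(lia).
have yE : (N - (N - y) = y)%N by lia.
suff : (1 <= slot_count n v t2 y%:Z)%N by lia.
by apply: slot_count_ge1 ltin _; rewrite -[in y%:Z]yE.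
Qed.

Lemma exists_2H_k2 n j : (6 + 4 * j <= n)%N -> exists_2H n (6 + 4 * j).
Proof.
move=> jn; set N := (3 * n + 2 * (j * n))%N.
have := odd_double_half n; set m := n./2; case: (odd n) => /= nE.
(* For odd [n] the shift by [m] reaches all rows, so the triple needs a constant row sum: [t0] and
   [t1] move up by one along the rows, [t2] moves down in steps of two, each up to a wrap-around. *)
- pose t0 i : int := i.+1%:Z.
  pose t1 i : int := (n + (if i <= m then i + m else i - m.+1).+1)%N%:Z.
  pose t2 i : int := (N - (if i <= m then 2 * i else 2 * (i - m.+1) + 1))%N%:Z.
  have sumE i : (i < n)%N -> t0 i + t1 i + t2 i = (N + n + m + 2)%N.
    by move=> ltin; rewrite /t0 /t1 /t2; case: (leqP i m) => ?; lia.
  apply: (@exists_2H_triples n j t0 t1 t2) => //.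
  + by move=> i ltin /=; rewrite !sumE // ltn_pmod; lia.
  + by move=> w wn; exists w.
  + move=> w wn; rewrite /t1; have [wm|mw] := ltnP w m.
      by exists (w + m.+1)%N; [lia | case: (leqP (w + m.+1) m) => ?; lia].
    by exists (w - m)%N; [lia | case: (leqP (w - m) m) => ?; lia].
  + move=> w wn; rewrite /t2 /same_class -/N; have := odd_double_half w.
    case: (odd w) => /= wE.
      by exists (w./2 + m.+1)%N; [lia | case: (leqP (w./2 + m.+1) m) => ?; lia].
    by exists w./2; [lia | case: (leqP w./2 m) => ?; lia].
(* For even [n], passing from row [i < m] to row [i + m] raises [t0] and [t1] by one and lowers [t2]
   by two. To this end the values in [t2] use the residues [0, 1] modulo [4] in the first half and
   [2, 3] in the second. *)
pose t0 i : int := (if i < m then 2 * i else 2 * (i - m) + 1)%N.+1%:Z.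
pose t1 i : int := n%:Z + t0 i.
(* For odd [m] the last value is [N + 1], which is the class of [N]. *)
pose t2 i : int := - (N - n + (if i < m then 4 * (i %/ 2) + i %% 2
  else 4 * ((i - m) %/ 2) + (i - m) %% 2 + 2).+1)%N%:Z.
have t0_onto w : (w < n)%N -> exists2 i, (i < n)%N & t0 i = w.+1%:Z.
  move=> wn; rewrite /t0; have := odd_double_half w; case: (odd w) => /= wE.
    by exists (w./2 + m)%N; [lia | case: (ltnP (w./2 + m) m) => ?; lia].
  by exists w./2; [lia | case: (ltnP w./2 m) => ?; lia].
apply: (@exists_2H_triples n j t0 t1 t2) => //.
- move=> i ltin /=; have [im|mi] := ltnP i m.
    rewrite modn_small; last by lia.
    by rewrite /t1 /t2 /t0 im ltnNge leq_addl /= addnK; lia.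
  have -> : ((i + m) %% n = i - m)%N.
    by rewrite (_ : i + m = i - m + n)%N ?modnDr ?modn_small; lia.
  have im : (i - m < m)%N by lia.
  by rewrite /t1 /t2 /t0 im (ltnNge i) mi /=; lia.
- by move=> w /t0_onto[i ltin ti]; exists i; rewrite // /t1 ti; lia.
move=> w wn; rewrite /t2 /same_class -/N.
pose o := (n - w.+1)%N; pose i := (2 * (o %/ 4) + o %% 2)%N.
have [o2|o2] := ltnP (o %% 4) 2; last first.
  by exists (i + m)%N; [lia | rewrite ltnNge leq_addl /= addnK; lia].
have [im|mi] := ltnP i m.
  by exists i; [lia | rewrite im; lia].
(* This occurs only for odd [m] and [o = n - 1]. The class is that of [N], and the last row carries
   [-(N + 1)]. *)
exists (m.-1 + m)%N; first by lia.
by rewrite ltnNge leq_addl /= addnK; lia.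
Qed.

(** * Odd [k] and even [n] *)

(** All row and column sums vanish identically in [c] and [K]. It remains to choose a sequence [c]
    such that [c], its translate [c - K] and the sums of cyclically consecutive terms, subtracted
    from [K], cover the right classes. *)
Definition diag3 (n : nat) (c : nat -> int) (K : int) : seq slot :=
  [:: (0%N, fun i => c (back n 1 i) - K); (1%N, fun i => K - c i - c (back n 1 i)); (2, c)].

Lemma row_sum_diag3 n c K i : row_sum (diag3 n c K) i = 0.
Proof. rewrite !row_sum_cons row_sum_nil /=; ring. Qed.

Lemma col_sum_diag3 n c K j : (2 < n)%N -> (j < n)%N -> col_sum n (diag3 n c K) j = 0.
Proof.
move=> n2 jn; rewrite !col_sum_cons col_sum_nil /= back0 (@backS n 1) //; ring.
Qed.

Lemma count_class_diag3 n v c K y : (1 < n)%N ->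
  count_class n v (diag3 n c K) y =
  (slot_count n v (fun i => (c i - K)%R) y +
   slot_count n v (fun i => (K - c i - c (back n 1 i))%R) y + slot_count n v c y)%N.
Proof.
move=> n1; rewrite !count_class_cons count_class_nil /= addn0 addnA.
by rewrite (@slot_count_back n v 1 (fun i => c i - K)).
Qed.

Section CenteredThree.
Variables (n : nat) (u : nat -> int).
Hypothesis n_gt2 : (2 < n)%N.
Hypothesis u_onto : forall w, (w < n)%N -> exists2 x, (x < n)%N & u x = w%:Z.

(** The constants make [c] run through the negatives of [s + 1, ..., s + n] and [c - K] through
    these numbers themselves, while the middle diagonal becomes [centered_sum], which does not
    depend on [s]. *)
Definition centered3 (s : nat) : seq slot :=
  diag3 n (fun x => - (s.+1%:Z + u x)) (- (2 * s + n + 1)%N%:Z).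

Definition centered_sum (x : nat) : int := u x + u (back n 1 x) - n.-1%:Z.

Lemma count_class_centered3 v s (y : nat) :
  count_class n v (centered3 s) y%:Z =
  (slot_count n v (fun x => ((s + n)%N%:Z - u x)%R) y%:Z +
   slot_count n v centered_sum y%:Z +
   slot_count n v (fun x => (- (s.+1%:Z + u x))%R) y%:Z)%N.
Proof.
rewrite /centered3 count_class_diag3; last by lia.
congr (_ + _ + _)%N; apply: eq_bigr => x _ /=.
- have -> // : - (s.+1%:Z + u x) - - (2 * s + n + 1)%N%:Z = (s + n)%N%:Z - u x by lia.
- rewrite /centered_sum; set e := (_ - _ - _); set e' := (_ + _ - _).
  by have -> // : e = e' by rewrite /e /e'; lia.
Qed.

Lemma count_class_centered3_high v s (y : nat) : (s < y <= s + n)%N ->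
  (2 <= count_class n v (centered3 s) y%:Z)%N.
Proof.
move=> sy; rewrite count_class_centered3.
have [x ltxn ux] := @u_onto (y - s.+1) ltac:(lia).
have [x' ltxn' ux'] := @u_onto (s + n - y) ltac:(lia).
have := @slot_count_at n v (fun x => (s + n)%N%:Z - u x) y _ _ ltxn' erefl.
have := @slot_count_at n v (fun x => - (s.+1%:Z + u x)) y _ _ ltxn erefl.
by rewrite /same_class ux ux'; lia.
Qed.

End CenteredThree.

(** With [s = n / 2], the centered sums take the classes up to [n / 2], the two outer diagonals
    those up to [3 * n / 2], and doubled pairs the rest. *)
Lemma exists_2H_centered3 n k u j : (2 < n)%N -> k = (3 + 4 * j)%N -> (k <= n)%N ->
  ~~ odd n -> (forall w, (w < n)%N -> exists2 x, (x < n)%N & u x = w%:Z) ->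
  (forall y v, (0 < y <= n./2)%N -> (2 <= slot_count n v (centered_sum n u) y%:Z)%N) ->
  exists_2H n k.
Proof.
move=> n2 kE kn n_even u_onto small.
have nE : n = (2 * n./2)%N by rewrite mul2n even_halfK.
set p := n./2 in nE small *.
apply: (@exists_2H_double n k 3 (2 * j) (2 * j) (centered3 n u p)
   (pairs n 3 j (3 * p) (3 * p + j * n))); try lia.
- by [].
- exact: pairs_offsets.
- by move=> i _; rewrite row_sum_diag3 dvdz0.
- by move=> i ltin; rewrite col_sum_diag3 ?dvdz0.
- by move=> i _; exact: row_sum_pairs.
move=> y y0 yv; have [yp|py] := leqP y p.
  by rewrite count_class_centered3 //; have := small y (n * k).+1; lia.
have [yp|{}py] := leqP y (p + n).
  by have := @count_class_centered3_high n u n2 u_onto (n * k).+1 p y; lia.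
suff : (1 <= count_class n (n * k).+1 (pairs n 3 j (3 * p) (3 * p + j * n)) y%:Z)%N by lia.
by apply: count_class_pairs; nia.
Qed.

(** Even positions ascend through the middle half of the values, odd positions through the top
    quarter and then the bottom one. The centered sum at [x] is [x] for [1 <= x <= 2 * r],
    [x - 4 * r] beyond, and [-2 * r] at [0], so each absolute value occurs twice. *)
Lemma exists_2H_n0_k3 r j : (3 + 4 * j <= 4 * r)%N -> exists_2H (4 * r) (3 + 4 * j).
Proof.
move=> jr.
pose u := interleave (fun i => (r + i)%N%:Z)
                     (fun i => (if i < r then 3 * r + i else i - r)%N%:Z).
have uE i : u (2 * i)%N = (r + i)%N by rewrite /u interleave_even.
have uO i : u (2 * i).+1 = (if i < r then 3 * r + i else i - r)%N.
  by rewrite /u interleave_odd.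
apply: (@exists_2H_centered3 _ _ u j) => //; try lia.
- move=> w wn; have [wr|rw] := ltnP w r.
    by exists (2 * (w + r)).+1; [lia | rewrite uO; case: (ltnP (w + r) r) => ?; lia].
  have [w3|w3] := ltnP w (3 * r).
    by exists (2 * (w - r))%N; [lia | rewrite uE; lia].
  exists (2 * (w - 3 * r)).+1; first by lia.
  by rewrite uO; case: (ltnP (w - 3 * r) r) => ?; lia.
have bO1 i : (i < r)%N -> centered_sum (4 * r) u (2 * i).+1 = (2 * i).+1%:Z.
  by move=> ir; rewrite /centered_sum back1S uO uE ir; lia.
have bO2 i : (r <= i < 2 * r)%N ->
    centered_sum (4 * r) u (2 * i).+1 = (2 * i).+1%:Z - (4 * r)%N%:Z.
  by move=> ir; rewrite /centered_sum back1S uO uE; case: (ltnP i r) => ?; lia.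
have bE1 i : (i < r)%N -> centered_sum (4 * r) u (2 * i.+1)%N = (2 * i.+1)%N%:Z.
  move=> ir; rewrite /centered_sum uE mulnS add2n back1S uO ir; lia.
have bE2 i : (r <= i < 2 * r)%N ->
    centered_sum (4 * r) u (2 * i.+1)%N = (2 * i.+1)%N%:Z - (4 * r)%N%:Z.
  by move=> ir; rewrite /centered_sum uE mulnS add2n back1S uO; case: (ltnP i r) => ?; lia.
have b0 : centered_sum (4 * r) u 0 = - (2 * r)%N%:Z.
  have -> : (0 = 2 * 0)%N by [].
  rewrite /centered_sum uE /back /=.
  have -> : (0 + 4 * r - 1 = (2 * (2 * r).-1).+1)%N by lia.
  by rewrite uO; case: (ltnP (2 * r).-1 r) => ?; lia.
move=> y v yr; have {yr} : (0 < y <= 2 * r)%N by lia.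
have := odd_double_half y; case: (odd y) => /= yE yr.
- by apply: (@slot_count_at2 _ _ _ _ (2 * y./2).+1 (2 * (2 * r - y./2.+1)).+1 _ _ _ _ _
    (bO1 _ _) (bO2 _ _)); rewrite /same_class; lia.
have [yr1|yr1] := ltnP y (2 * r).
- by apply: (@slot_count_at2 _ _ _ _ (2 * y./2.-1.+1) (2 * (2 * r - y./2.+1).+1) _ _ _ _ _
    (bE1 _ _) (bE2 _ _)); rewrite /same_class; lia.
by apply: (@slot_count_at2 _ _ _ _ (2 * y./2.-1.+1) 0 _ _ _ _ _
    (bE1 _ _) b0); rewrite /same_class; lia.
Qed.

(** A plain zigzag between the lower and the upper half would have a consecutive sum [n - 1], hence
    a centered sum [0]. Moving the value [3 * r] to the odd position [2 * r + 1] avoids this, at the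
    price of a few exceptional sums: [2 * r], [-1], [2 * r + 1] and [-2]. *)
Lemma exists_2H_n2_k3 r j : (0 < r)%N -> (3 + 4 * j <= 4 * r + 2)%N ->
  exists_2H (4 * r + 2) (3 + 4 * j).
Proof.
move=> r0 jr; set n := (4 * r + 2)%N in jr *.
pose E i := (if i < r then 2 * r + i else 2 * r + i.+1)%N.
pose O i := (if i < r then i else if i == r then 3 * r else i.-1)%N.
pose u := interleave (fun i => (E i)%:Z) (fun i => (O i)%:Z).
have uE i : u (2 * i)%N = E i by rewrite /u interleave_even.
have uO i : u (2 * i).+1 = O i by rewrite /u interleave_odd.
have E1 i : (i < r)%N -> E i = (2 * r + i)%N by rewrite /E => ->.
have E2 i : (r <= i)%N -> E i = (2 * r + i.+1)%N by rewrite /E ltnNge => ->.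
have O1 i : (i < r)%N -> O i = i by rewrite /O => ->.
have O2 : O r = (3 * r)%N by rewrite /O ltnn eqxx.
have O3 i : (r < i)%N -> O i = i.-1.
  by move=> ri; rewrite /O; case: (ltnP i r) => ?; case: (i =P r) => ?; lia.
have n_half : n./2 = (2 * r).+1 by rewrite /n; lia.
apply: (@exists_2H_centered3 _ _ u j) => //; try (rewrite /n; lia).
- move=> w wn; have [w1|w1] := ltnP w r.
    by exists (2 * w).+1; [lia | rewrite uO O1].
  have [w2|w2] := ltnP w (2 * r).
    by exists (2 * w.+1).+1; [lia | rewrite uO O3].
  have [w3|w3] := ltnP w (3 * r).
    by exists (2 * (w - 2 * r))%N; [lia | rewrite uE E1; lia].
  have [w4|w4] := ltnP (3 * r) w.
    by exists (2 * (w - (2 * r).+1))%N; [lia | rewrite uE E2; lia].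
  by exists (2 * r).+1; [lia | rewrite uO O2; lia].
pose b := centered_sum n u.
have bO i : b (2 * i).+1 = (O i + E i)%N%:Z - (4 * r + 1)%N%:Z.
  by rewrite /b /centered_sum back1S uO uE; lia.
have bE i : b (2 * i.+1)%N = (E i.+1 + O i)%N%:Z - (4 * r + 1)%N%:Z.
  by rewrite /b /centered_sum uE mulnS add2n back1S uO; lia.
have bO1 i : (i < r)%N -> b (2 * i).+1 = (2 * i)%N%:Z - (2 * r + 1)%N%:Z.
  by move=> ir; rewrite bO O1 // E1 //; lia.
have bO2 : b (2 * r).+1 = (2 * r)%N%:Z by rewrite bO O2 E2 //; lia.
have bO3 i : (r < i)%N -> b (2 * i).+1 = (2 * i)%N%:Z - (2 * r + 1)%N%:Z.
  by move=> ri; rewrite bO O3 // E2; lia.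
have bE1 i : (i.+1 < r)%N -> b (2 * i.+1)%N = (2 * i)%N%:Z - (2 * r)%N%:Z.
  by move=> ir; rewrite bE E1 // O1; lia.
have bE2 : b (2 * r.-1.+1)%N = - 1 by rewrite bE E2 ?O1; lia.
have bE3 : b (2 * r.+1)%N = (2 * r + 1)%N by rewrite bE O2 E2; lia.
have bE4 i : (r < i)%N -> b (2 * i.+1)%N = (2 * i)%N%:Z - (2 * r)%N%:Z.
  by move=> ri; rewrite bE O3 // E2; lia.
have b0 : b 0%N = - 2.
  have -> : (0 = 2 * 0)%N by [].
  rewrite /b /centered_sum uE /back /=.
  have -> : (0 + n - 1 = (2 * (2 * r)).+1)%N by lia.
  by rewrite uO E1 // O3; lia.
rewrite n_half => y v yr; rewrite -/b.
have at2 i i' : (i < n)%N -> (i' < n)%N -> i != i' -> `|b i|%N = y -> `|b i'|%N = y ->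
    (2 <= slot_count n v b y%:Z)%N.
  by move=> *; apply: (@slot_count_ge2 _ _ _ _ i i'); rewrite /same_class; lia.
have := odd_double_half y; case: (odd y) => /= yE.
- have [yr1|yr1] := ltnP y (2 * r).
    have [y1|y1] := ltnP 1 y; last first.
      by apply: (at2 (2 * r.-1.+1)%N (2 * r.+1).+1); rewrite ?bE2 ?bO3; lia.
    apply: (at2 (2 * (r - y./2)).+1 (2 * (r + y./2.+1)).+1);
      [lia.. | rewrite bO1; lia | rewrite bO3; lia].
  by apply: (at2 (2 * 0).+1 (2 * r.+1)%N); rewrite ?bE3 ?bO1; lia.
have [yr1|yr1] := ltnP y (2 * r); last first.
  (* [bE1] starts at [-2 * r] only for [r > 1]; for [r = 1] the value [-2] comes from position
     [0]. *)
  have [r1|r1] := ltnP 1 r.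
    by apply: (at2 (2 * 0.+1)%N (2 * r).+1); rewrite ?bE1 ?bO2; lia.
  by apply: (at2 0%N (2 * r).+1); rewrite ?b0 ?bO2; lia.
have [y2|y2] := ltnP 2 y; last first.
  by apply: (at2 0%N (2 * r.+1.+1)%N); rewrite ?b0 ?bE4; lia.
apply: (at2 (2 * (r - y./2).+1)%N (2 * (r + y./2).+1)%N);
  [lia.. | rewrite bE1; lia | rewrite bE4; lia].
Qed.

(** This is [diag3] perturbed by [t]: again all sums vanish identically, and the last two diagonals
    use each class of [t] twice. *)
Definition diag5 (n : nat) (c t : nat -> int) (K : int) : seq slot :=
  [:: (0%N, fun i => c (back n 1 i) - t (back n 1 i) - K);
      (1%N, fun i => K - c i - c (back n 1 i) + t i);
      (2, c); (3, fun i => t (back n 1 i)); (4, fun i => - t i)].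

Lemma row_sum_diag5 n c t K i : row_sum (diag5 n c t K) i = 0.
Proof. rewrite !row_sum_cons row_sum_nil /=; ring. Qed.

Lemma col_sum_diag5 n c t K j : (4 < n)%N -> (j < n)%N -> col_sum n (diag5 n c t K) j = 0.
Proof.
move=> n4 jn; rewrite !col_sum_cons col_sum_nil /= back0.
rewrite (@backS n 1) ?(@backS n 3) //; [ring | lia..].
Qed.

Lemma count_class_diag5 n v c t K y : (4 < n)%N ->
  count_class n v (diag5 n c t K) y =
  (slot_count n v (fun i => (c i - t i - K)%R) y +
   slot_count n v (fun i => (K - c i - c (back n 1 i) + t i)%R) y +
   slot_count n v c y + 2 * slot_count n v t y)%N.
Proof.
move=> n4; rewrite !count_class_cons count_class_nil /= slot_countN.
rewrite (@slot_count_back n v 1 (fun i => c i - t i - K)) ?(@slot_count_back n v 1 t) //; lia.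
Qed.

(** [t] takes the top [n] classes and the pairs those from [3 * p + 1] up to them. Below, the first
    diagonal covers [p + 1, ..., 3 * p], the second [1] twice and [2, ..., p] and
    [p + 2, ..., 2 * p], and [c] covers [2, ..., p + 1] and [2 * p + 1, ..., 3 * p]. *)
Lemma exists_2H_even_k1 p j : (5 + 4 * j <= 2 * p)%N -> exists_2H (2 * p) (5 + 4 * j).
Proof.
move=> jp; set n := (2 * p)%N in jp *.
pose N := (5 * p + j * n + j * n)%N.
pose cE i := (i%:Z - (3 * p)%N%:Z) : int.
pose cO i := - (2 + i)%N%:Z : int.
pose tE i := (N%:Z - i%:Z) : int.
pose tO i := (i%:Z + p%:Z - N%:Z) : int.
pose c := interleave cE cO; pose t := interleave tE tO.
pose K := (N%:Z - (4 * p + 1)%N%:Z) : int.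
have cEE i : c (2 * i)%N = cE i by rewrite /c interleave_even.
have cOE i : c (2 * i).+1 = cO i by rewrite /c interleave_odd.
have tEE i : t (2 * i)%N = tE i by rewrite /t interleave_even.
have tOE i : t (2 * i).+1 = tO i by rewrite /t interleave_odd.
have vE : (n * (5 + 4 * j)).+1 = (2 * N).+1 by rewrite /N /n; lia.
apply: (@exists_2H_double n _ 5 (2 * j) (2 * j) (diag5 n c t K)
   (pairs n 5 j (3 * p) (3 * p + j * n))); rewrite ?vE; try lia.
- by [].
- exact: pairs_offsets.
- by move=> i _; rewrite row_sum_diag5 dvdz0.
- by move=> i ltin; rewrite col_sum_diag5 ?dvdz0 //; lia.
- by move=> i _; exact: row_sum_pairs.
set v := (2 * N).+1 => y y0 yv.
rewrite count_class_diag5; last by lia.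
set a := (X in (slot_count _ _ X _ + _ + _ + _)%N).
set b := (X in (_ + slot_count _ _ X _ + _ + _ + _)%N).
have at_ f i : (i < n)%N -> same_class v (f i) y -> (1 <= slot_count n v f y%:Z)%N.
  exact: slot_count_ge1.
have aE i : a (2 * i)%N = (p + 2 + 2 * i)%N%:Z - v%:Z.
  by rewrite /a cEE tEE /cE /tE /K /v; lia.
have aO i : a (2 * i).+1 = (3 * p)%N%:Z - (1 + 2 * i)%N%:Z.
  by rewrite /a cOE tOE /cO /tO /K; lia.
have bE i : b (2 * i.+1)%N = v%:Z - (p + 2 + i)%N%:Z.
  rewrite /b cEE tEE mulnS add2n back1S cOE /cE /tE /K /cO /v; lia.
have bO i : b (2 * i).+1 = (1 + i)%N%:Z.
  by rewrite /b back1S cOE tOE cEE /cO /tO /cE /K; lia.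
have b0 : b 0%N = v%:Z - 1.
  have -> : (0 = 2 * 0)%N by [].
  rewrite /b cEE tEE /back /=; have -> : (0 + n - 1 = (2 * p.-1).+1)%N by lia.
  by rewrite cOE /cO /cE /tE /K /v; lia.
have a_mid : (p + 1 <= y <= 3 * p)%N -> (1 <= slot_count n v a y%:Z)%N.
  move=> yp; have := odd_double_half (y - p); case: (odd _) => /= yE; last first.
    have [y2|y2] := ltnP (p + 1) y; last by lia.
    by apply: (at_ a (2 * (y - p)./2.-1)%N); rewrite ?aE /same_class; lia.
  by apply: (at_ a (2 * (p - (y - p)./2.+1)).+1); rewrite ?aO /same_class; lia.
have [y1|y1] := leqP y p.
  have hb : (1 <= slot_count n v b y%:Z)%N.
    by apply: (at_ b (2 * y.-1).+1); rewrite ?bO /same_class; lia.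
  have [y2|y2] := ltnP 1 y.
    suff : (1 <= slot_count n v c y%:Z)%N by lia.
    by apply: (at_ c (2 * (y - 2)).+1); rewrite ?cOE /cO /same_class; lia.
  suff : (2 <= slot_count n v b y%:Z)%N by lia.
  by apply: (@slot_count_ge2 _ _ _ _ (2 * 0).+1 0); rewrite ?b0 ?bO /same_class; lia.
have [y2|y2] := leqP y (3 * p).
  have := a_mid ltac:(lia).
  have [y3|y3] := leqP y (p + 1).
    suff : (1 <= slot_count n v c y%:Z)%N by lia.
    by apply: (at_ c (2 * (y - 2)).+1); rewrite ?cOE /cO /same_class; lia.
  have [y4|y4] := leqP y (2 * p).
    suff : (1 <= slot_count n v b y%:Z)%N by lia.
    by apply: (at_ b (2 * (y - (p + 2)).+1)%N); rewrite ?bE /same_class; lia.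
  suff : (1 <= slot_count n v c y%:Z)%N by lia.
  by apply: (at_ c (2 * (3 * p - y))%N); rewrite ?cEE /cE /same_class; lia.
have [y3|y3] := leqP y (3 * p + j * n + j * n).
  suff : (1 <= count_class n v (pairs n 5 j (3 * p) (3 * p + j * n)) y%:Z)%N by lia.
  by apply: count_class_pairs; lia.
suff : (1 <= slot_count n v t y%:Z)%N by lia.
have [y4|y4] := leqP y (N - p).
  by apply: (at_ t (2 * (N - p - y)).+1); rewrite ?tOE /tO /same_class; lia.
by apply: (at_ t (2 * (N - y))%N); rewrite ?tEE /tE /same_class; lia.
Qed.

(** * Odd [k] and odd [n] *)

(** Here [v / 2 = 6 * e + 2]. The even terms of [c] are symmetric about it and settle all classes
    from [5 * e + 2] on; the odd terms cover [1, ..., 2 * e]. The first diagonal covers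
    [2 * e + 1, ..., 3 * e] twice and [3 * e + 1, ..., 5 * e + 1] once; the middle one supplies the
    second occurrences in [1, ..., 2 * e] and [3 * e + 1, ..., 5 * e + 1]. *)
Lemma exists_2H_n1_k_eq3 e : (0 < e)%N -> exists_2H (4 * e + 1) 3.
Proof.
move=> e0; set n := (4 * e + 1)%N.
pose E i := (5 * e + 2 + i)%N%:Z : int.
pose O i := (if (i < e)%N then i%:Z - (2 * e)%N%:Z else (i.+1)%:Z - e%:Z) : int.
pose c := interleave E O.
pose K := (3 * e + 1)%N%:Z : int.
have cE i : c (2 * i)%N = E i by rewrite /c interleave_even.
have cO i : c (2 * i).+1 = O i by rewrite /c interleave_odd.
have O1 i : (i < e)%N -> O i = i%:Z - (2 * e)%N%:Z by rewrite /O => ->.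
have O2 i : (e <= i)%N -> O i = (i.+1)%:Z - e%:Z by rewrite /O ltnNge => ->.
apply: (@exists_2H_double n 3 3 0 0 (diag3 n c K) [::]) => //; try lia.
- by move=> i _; rewrite row_sum_diag3 dvdz0.
- by move=> i ltin; rewrite col_sum_diag3 ?dvdz0 //; lia.
- by move=> i _; rewrite !row_sum_nil.
have vE : (n * 3).+1 = (12 * e + 4)%N by lia.
rewrite vE; set v := (12 * e + 4)%N => y y0 yv.
rewrite count_class_nil addn0 count_class_diag3; last by lia.
set a := (X in (slot_count _ _ X _ + _ + _)%N); set b := (X in (_ + slot_count _ _ X _ + _)%N).
have aE i : a (2 * i)%N = (2 * e + 1 + i)%N%:Z by rewrite /a cE /E /K; lia.
have aO i : a (2 * i).+1 = O i - K by rewrite /a cO.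
have bO i : b (2 * i).+1 = K - O i - E i by rewrite /b back1S cO cE.
have bE i : b (2 * i.+1)%N = K - E i.+1 - O i.
  by rewrite /b cE mulnS add2n back1S cO.
have b0 : b 0%N = - (9 * e + 3)%N%:Z.
  have -> : (0 = 2 * 0)%N by [].
  rewrite /b cE /back /=; have -> : (0 + n - 1 = 2 * (2 * e))%N by lia.
  by rewrite cE /E /K; lia.
have at_ f i : (i < n)%N -> same_class v (f i) y -> (1 <= slot_count n v f y%:Z)%N.
  exact: slot_count_ge1.
have b_small : (y <= 2 * e)%N -> (1 <= slot_count n v b y%:Z)%N.
  move=> ye; have := odd_double_half y; case: (odd y) => /= yE.
    by apply: (at_ b (2 * y./2).+1); rewrite ?bO ?O1 /same_class /K /E; lia.
  by apply: (at_ b (2 * y./2.-1.+1)%N); rewrite ?bE ?O1 /same_class /K /E; lia.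
have b_mid : (3 * e + 1 <= y <= 5 * e + 1)%N -> (1 <= slot_count n v b y%:Z)%N.
  move=> ye; have [y1|y1] := ltnP (3 * e + 1) y; last first.
    by apply: (at_ b 0%N); rewrite ?b0 /same_class /v; lia.
  have := odd_double_half (y - e); case: (odd _) => /= yE.
    by apply: (at_ b (2 * (y - e)./2.-1.+1)%N); rewrite ?bE ?O2 /same_class /K /E; lia.
  by apply: (at_ b (2 * (y - e)./2.-1).+1); rewrite ?bO ?O2 /same_class /K /E; lia.
have a_even : (2 * e + 1 <= y <= 4 * e + 1)%N -> (1 <= slot_count n v a y%:Z)%N.
  by move=> ye; apply: (at_ a (2 * (y - (2 * e + 1)))%N); rewrite ?aE /same_class; lia.
have [y1|y1] := leqP y (2 * e).
  suff : (1 <= slot_count n v c y%:Z)%N by have := b_small y1; lia.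
  have [y2|y2] := leqP y e.
    by apply: (at_ c (2 * (e + y.-1)).+1); rewrite ?cO ?O2 /same_class; lia.
  by apply: (at_ c (2 * (2 * e - y)).+1); rewrite ?cO ?O1 /same_class; lia.
have [y2|y2] := leqP y (3 * e).
  suff : (2 <= slot_count n v a y%:Z)%N by lia.
  apply: (@slot_count_ge2 _ _ _ _ (2 * (y - (2 * e + 1))) (2 * (4 * e - y)).+1);
    rewrite ?aE ?aO ?O2 /same_class /K; lia.
have [y3|y3] := leqP y (4 * e + 1).
  by have := a_even ltac:(lia); have := b_mid ltac:(lia); lia.
have [y4|y4] := leqP y (5 * e + 1).
  suff : (1 <= slot_count n v a y%:Z)%N by have := b_mid ltac:(lia); lia.
  by apply: (at_ a (2 * (5 * e + 1 - y)).+1); rewrite ?aO ?O1 /same_class /K; lia.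
suff : (2 <= slot_count n v c y%:Z)%N by lia.
have [y5|y5] := ltnP y (6 * e + 2).
  apply: (@slot_count_ge2 _ _ _ _ (2 * (y - (5 * e + 2))) (2 * (7 * e + 2 - y)));
    rewrite ?cE /same_class /E /v; lia.
by apply: (@slot_count_half _ _ _ _ (2 * e)%N); rewrite ?cE /same_class /E /v; lia.
Qed.

(** After a shift of the columns by two, the cells [(i, i + 2)] and [(i + 2, i)] both carry [g i],
    and [(i, i + 1)], [(i + 1, i)] carry [f i] and [f i + M]. Row and column of the same index thus
    have equal sums, which the main diagonal cancels. *)
Definition sym5 (n : nat) (f g : nat -> int) (M : int) : seq slot :=
  [:: (0%N, fun i => g (back n 2 i)); (1%N, fun i => f (back n 1 i) + M);
      (2, fun i => - M - f i - f (back n 1 i) - g i - g (back n 2 i)); (3, f); (4, g)].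

Lemma row_sum_sym5 n f g M i : row_sum (sym5 n f g M) i = 0.
Proof. rewrite !row_sum_cons row_sum_nil /=; ring. Qed.

Lemma col_sum_sym5 n f g M j : (4 < n)%N -> (j < n)%N -> col_sum n (sym5 n f g M) j = 0.
Proof.
move=> n4 jn; rewrite !col_sum_cons col_sum_nil /= back0.
have -> : back n 4 j = back n 2 (back n 2 j).
  by rewrite (@backS n 3) ?(@backS n 2) ?(@backS n 1 (back n 2 j)) ?back_lt //; lia.
have -> : back n 3 j = back n 1 (back n 2 j) by rewrite (@backS n 2) //; lia.
have -> : back n 1 (back n 1 j) = back n 2 j by rewrite (@backS n 1) //; lia.
ring.
Qed.

Lemma count_class_sym5 n v f g M y : (4 < n)%N ->
  count_class n v (sym5 n f g M) y =
  (slot_count n v (fun i => (f i + M)%R) y +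
   slot_count n v (fun i => (- M - f i - f (back n 1 i) - g i - g (back n 2 i))%R) y +
   slot_count n v f y + 2 * slot_count n v g y)%N.
Proof.
move=> n4; rewrite !count_class_cons count_class_nil /=.
rewrite (@slot_count_back n v 1 (fun i => f i + M)) ?(@slot_count_back n v 2 g) //; lia.
Qed.

(** [f] and [f + M] together cover [1, ..., n] twice, each meeting [m + 1] once; [g] covers
    [w + n + 1, ..., w + 2 * n]; the pairs fill the intervals of length [w] on both sides of it. The
    main diagonal [b] has to cover twice all classes above [2 * n + 2 * w]. *)
Lemma exists_2H_n3_k1 e j : (5 + 4 * j <= 4 * e + 3)%N ->
  exists_2H (4 * e + 3) (5 + 4 * j).
Proof.
move=> je; set n := (4 * e + 3)%N in je *.
pose m := (2 * e + 1)%N; pose w := (j * n)%N.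
pose f := interleave (fun i => - (1 + i)%N%:Z) (fun i => - (1 + i)%N%:Z).
pose G := interleave (fun s => - (w + n + 1 + s)%N%:Z) (fun s => s%:Z - (w + 2 * n)%N%:Z).
(* As [n] is odd, steps of two pass through all rows. [g] reads [G] along them, so [g i + g (i - 2)]
   is a sum of consecutive terms of the zigzag [G]. *)
pose g := interleave G (fun i => G (m + 1 + i)%N).
pose M : int := n.+1%:Z.
have fE i : f (2 * i)%N = - (1 + i)%N%:Z by rewrite /f interleave_even.
have fO i : f (2 * i).+1 = - (1 + i)%N%:Z by rewrite /f interleave_odd.
have GE s : G (2 * s)%N = - (w + n + 1 + s)%N%:Z by rewrite /G interleave_even.
have GO s : G (2 * s).+1 = s%:Z - (w + 2 * n)%N%:Z by rewrite /G interleave_odd.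
have gE i : g (2 * i)%N = G i by rewrite /g interleave_even.
have gO i : g (2 * i).+1 = G (m + 1 + i)%N by rewrite /g interleave_odd.
have vE : (n * (5 + 4 * j)).+1 = (5 * n + 4 * w + 1)%N by rewrite /w; lia.
apply: (@exists_2H_double n _ 5 (2 * j) (2 * j) (sym5 n f g M)
   (pairs n 5 j n (2 * n + w))); rewrite ?vE; try lia.
- by [].
- exact: pairs_offsets.
- by move=> i _; rewrite row_sum_sym5 dvdz0.
- by move=> i ltin; rewrite col_sum_sym5 ?dvdz0 //; lia.
- by move=> i _; exact: row_sum_pairs.
set v := (5 * n + 4 * w + 1)%N => y y0 yv.
rewrite count_class_sym5; last by lia.
set f' := (X in (slot_count _ _ X _ + _ + _ + _)%N).
set b := (X in (_ + slot_count _ _ X _ + _ + _ + _)%N).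
have at_ h i : (i < n)%N -> same_class v (h i) y -> (1 <= slot_count n v h y%:Z)%N.
  exact: slot_count_ge1.
have at2 h i i' : (i < n)%N -> (i' < n)%N -> i != i' -> same_class v (h i) y ->
    same_class v (h i') y -> (2 <= slot_count n v h y%:Z)%N by exact: slot_count_ge2.
have back1S2 i : back n 1 (2 * i.+1)%N = (2 * i).+1 by rewrite mulnS add2n back1S.
have back2S i : back n 2 i.+2 = i by rewrite /back /= subn2.
have back2E i : back n 2 (2 * i.+1)%N = (2 * i)%N by rewrite mulnS add2n back2S.
have back2O i : back n 2 (2 * i.+1).+1 = (2 * i).+1 by rewrite mulnS add2n back2S.
have bE i : b (2 * i.+1)%N = - M + (2 * i.+1).+1%:Z - G i.+1 - G i.
  by rewrite /b back1S2 back2E fE fO !gE; lia.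
have bO i : b (2 * i).+1 = - M + (2 * i.+1)%N%:Z - G (m + i).+1 - G (m + i)%N.
  rewrite /b back1S fO fE gO; case: i => [|i]; last first.
    rewrite back2O gO (_ : (m + 1 + i = m + i.+1)%N); last by lia.
    by rewrite (_ : (m + 1 + i.+1 = (m + i.+1).+1)%N); lia.
  have -> : back n 2 (2 * 0).+1 = (2 * m)%N by rewrite muln0 /back /=; lia.
  by rewrite gE !addn0 addn1; lia.
have b0 : b 0%N = (2 * w + 2 * n + 2)%N.
  have -> : (0 = 2 * 0)%N by [].
  rewrite /b fE gE; have -> : back n 1 (2 * 0) = (2 * m)%N by rewrite muln0 /back /=; lia.
  have -> : back n 2 (2 * 0) = (2 * m.-1).+1 by rewrite muln0 /back /=; lia.
  rewrite fE gO (_ : (m + 1 + m.-1 = 2 * m)%N); last by lia.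
  by rewrite (GE 0%N) GE; lia.
have b1 s : b (2 * (2 * s))%N = (2 * w + 2 * n + 2 + 4 * s)%N.
  case: s => [|s]; first by rewrite b0; lia.
  have -> : (2 * s.+1 = (2 * s).+1.+1)%N by lia.
  rewrite bE GO (_ : (2 * s).+2 = 2 * s.+1)%N; last by lia.
  by rewrite GE; lia.
have b2 s : b (2 * (2 * s)).+1 = (2 * w + 2 * n + 3 + 4 * s)%N.
  rewrite bO (_ : (m + 2 * s = (2 * (e + s)).+1)%N); last by lia.
  rewrite GO (_ : (2 * (e + s)).+2 = 2 * (e + s).+1)%N; last by lia.
  by rewrite GE; lia.
have b3 s : b (2 * (2 * s).+1)%N = (2 * w + 2 * n + 3 + 4 * s)%N.
  by rewrite bE GO GE; lia.
have b4 s : b (2 * (2 * s).+1).+1 = (2 * w + 2 * n + 4 + 4 * s)%N.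
  rewrite bO (_ : (m + (2 * s).+1 = 2 * (e + s).+1)%N); last by lia.
  by rewrite GO GE; lia.
have [y1|y1] := leqP y m.
  suff : (2 <= slot_count n v f y%:Z)%N by lia.
  by apply: (at2 f (2 * y.-1)%N (2 * y.-1).+1); rewrite ?fE ?fO /same_class; lia.
have [y2|y2] := leqP y (m + 1).
  have : (1 <= slot_count n v f y%:Z)%N.
    by apply: (at_ f (2 * m)%N); rewrite ?fE /same_class; lia.
  suff : (1 <= slot_count n v f' y%:Z)%N by lia.
  by apply: (at_ f' (2 * m)%N); rewrite /f' ?fE /same_class; lia.
have [y3|y3] := leqP y n.
  suff : (2 <= slot_count n v f' y%:Z)%N by lia.
  by apply: (at2 f' (2 * (n - y))%N (2 * (n - y)).+1); rewrite /f' ?fE ?fO /same_class; lia.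
have [y4|y4] := leqP y (n + w).
  suff : (1 <= count_class n v (pairs n 5 j n (2 * n + w)) y%:Z)%N by lia.
  by apply: count_class_pairs; lia.
have [y5|y5] := leqP y (2 * n + w).
  suff : (1 <= slot_count n v g y%:Z)%N by lia.
  have [i [im Gi]] : exists i, (i < n)%N /\ G i = - y%:Z.
    have [y6|y6] := leqP y (w + n + 1 + m).
      by exists (2 * (y - (w + n + 1)))%N; rewrite GE; lia.
    by exists (2 * (w + 2 * n - y)).+1; rewrite GO; lia.
  have [i1|i1] := leqP i m.
    by apply: (at_ g (2 * i)%N); rewrite ?gE ?Gi /same_class; lia.
  apply: (at_ g (2 * (i - (m + 1))).+1); first by lia.
  by rewrite gO (_ : (m + 1 + (i - (m + 1)) = i)%N) ?Gi /same_class; lia.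
have [y6|y6] := leqP y (2 * n + 2 * w).
  suff : (1 <= count_class n v (pairs n 5 j n (2 * n + w)) y%:Z)%N by lia.
  by apply: count_class_pairs; lia.
suff : (2 <= slot_count n v b y%:Z)%N by lia.
(* The values of [b] lie on both sides of [v / 2], and the residue of [o] modulo [4] tells which of
   them represent [y]: directly for residue [2], through [v - y] for residue [0], once in each way
   for residues [1] and [3]. *)
pose o := (y - (2 * n + 2 * w + 1))%N.
have [yh|yh] := leqP v (2 * y).
  have := odd_double_half e; case: (odd e) => /= eE.
    by apply: (@slot_count_half _ _ _ _ (2 * (2 * e./2).+1).+1); rewrite ?b4 /same_class; lia.
  by apply: (@slot_count_half _ _ _ _ (2 * (2 * e./2))%N); rewrite ?b1 /same_class; lia.
have := divn_eq o 4; have := @ltn_pmod o 4 isT.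
set s := (o %/ 4)%N; case: (o %% 4)%N => [|[|[|[|//]]]] _ oE.
- by apply: (at2 b (2 * (2 * (e - s))).+1 (2 * (2 * (e - s)).+1)%N);
    rewrite ?b2 ?b3 /same_class; lia.
- by apply: (at2 b (2 * (2 * s))%N (2 * (2 * (e - s)))%N); rewrite ?b1 /same_class; lia.
- by apply: (at2 b (2 * (2 * s)).+1 (2 * (2 * s).+1)%N); rewrite ?b2 ?b3 /same_class; lia.
- by apply: (at2 b (2 * (2 * s).+1).+1 (2 * (2 * (e - s.+1)).+1).+1);
    rewrite ?b4 /same_class; lia.
Qed.

Definition bump (r : nat) (h : int) (f : nat -> int) (i : nat) : int :=
  f i + (if i == r then h else 0).

Lemma bumpN r h f i : i != r -> bump r h f i = f i.
Proof. by rewrite /bump => /negbTE->; rewrite addr0. Qed.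

Lemma bumpE r h f : bump r h f r = f r + h.
Proof. by rewrite /bump eqxx. Qed.

(* Adding [h] in the cells [(r + 3, r + 3)], [(r + 3, r + 4)], [(r, r + 3)], [(r, r + 4)] of a
   rectangle changes two row sums and two column sums by [2 * h]. *)
Definition bumped7 (n r : nat) (h : int) (c : nat -> int) (K : int) (p q : nat -> int) :
    seq slot :=
  [:: (0%N, bump (r + 3) h (fun i => c (back n 1 i) - K));
      (1%N, bump (r + 3) h (fun i => K - c i - c (back n 1 i))); (2, c);
      (3, bump r h p); (4, bump r h q);
      (5, fun i => - p ((i + 2) %% n)%N); (6, fun i => - q ((i + 2) %% n)%N)].

Lemma row_sum_bumped7 n r h c K p q i : (2 * h %| p i + q i - p ((i + 2) %% n)%N -
    q ((i + 2) %% n)%N)%Z -> (2 * h %| row_sum (bumped7 n r h c K p q) i)%Z.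
Proof.
rewrite !row_sum_cons row_sum_nil /bump /= => pq.
set x := (if i == (r + 3)%N then h else 0); set y := (if i == r then h else 0).
have [x2 y2] : (2 * h %| 2 * x)%Z /\ (2 * h %| 2 * y)%Z.
  by rewrite /x /y; split; case: ifP => _; rewrite ?mulr0 ?dvdz0 ?dvdzz.
have := rpredD (rpredD pq x2) y2; congr (_ %| _)%Z; ring.
Qed.

Lemma col_sum_bumped7 n r h c K p q j : (6 < n)%N -> (r + 4 < n)%N -> (j < n)%N ->
  (2 * h %| col_sum n (bumped7 n r h c K p q) j)%Z.
Proof.
move=> n6 rn jn; rewrite !col_sum_cons col_sum_nil /bump /=.
have pE : ((back n 5 j + 2) %% n)%N = back n 3 j by rewrite (@back_add n 3 2) //; lia.
have qE : ((back n 6 j + 2) %% n)%N = back n 4 j by rewrite (@back_add n 4 2) //; lia.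
have e0 : (back n 0 j == (r + 3)%N) = (back n 3 j == r).
  by rewrite /back; case: (leqP 0 j) => ?; case: (leqP 3 j) => ?; lia.
have e1 : (back n 1 j == (r + 3)%N) = (back n 4 j == r).
  by rewrite /back; case: (leqP 1 j) => ?; case: (leqP 4 j) => ?; lia.
rewrite pE qE e0 e1 back0 (@backS n 1 j) //; last by lia.
set x := (if back n 3 j == r then h else 0); set y := (if back n 4 j == r then h else 0).
have [x2 y2] : (2 * h %| 2 * x)%Z /\ (2 * h %| 2 * y)%Z.
  by rewrite /x /y; split; case: ifP => _; rewrite ?mulr0 ?dvdz0 ?dvdzz.
have := rpredD x2 y2; congr (_ %| _)%Z; ring.
Qed.

(** Before the bump, the integer array covers every class from [1] to [v / 2 - 1] twice and has one
    entry [0]. Adding [v / 2] in the rectangle turns [0] into the missing [v / 2], keeps the class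
    of [q = v / 4], and interchanges the classes of [x] and [v / 2 - x]. *)
Lemma exists_2H_n1_k3 e j : (7 + 4 * j <= 4 * e + 1)%N ->
  exists_2H (4 * e + 1) (7 + 4 * j).
Proof.
move=> je; set n := (4 * e + 1)%N in je *.
pose m := (2 * e)%N; pose w := (j * n)%N; pose r := (m - 3)%N.
pose u := interleave (fun i => i%:Z) (fun i => (m + 1 + i)%N%:Z).
have uE i : u (2 * i)%N = i by rewrite /u interleave_even.
have uO i : u (2 * i).+1 = (m + 1 + i)%N by rewrite /u interleave_odd.
have u_onto x : (x < n)%N -> exists2 i, (i < n)%N & u i = x%:Z.
  move=> xn; have [xm|mx] := leqP x m; first by exists (2 * x)%N; rewrite ?uE; lia.
  by exists (2 * (x - m.+1)).+1; rewrite ?uO; lia.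
(* The rectangle carries the absolute values [0], [x], [q] and [2 * q - x], where [4 * q = v]. *)
pose x := (3 * e + 1)%N; pose q := (x + n + w)%N; pose h : int := (2 * q)%N%:Z.
have vE : (n * (7 + 4 * j)).+1 = (4 * q)%N by rewrite /q /x /w /n; lia.
(* A cyclic shift with [rho r = e], which puts [q] and [-(2 * q - x)] into the rectangle as [P r]
   and [Q r]. It cancels in [P i + Q i], so the row sums are unaffected. *)
pose rho i := ((i + n - r + e) %% n)%N.
pose P i : int := (m + n + w + 1 + rho i)%N%:Z.
pose Q i : int := - (m + 2 * n + 2 * w + 1 + rho i)%N%:Z.
pose c i : int := - (m.+1%:Z + u i).
pose K : int := - (2 * m + n + 1)%N%:Z.
pose B := pairs n 7 j (m + n) (m + 2 * n + w).
have rho_lt i : (rho i < n)%N by rewrite /rho ltn_pmod // /n; lia.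
have rhoP y : (y < n)%N -> exists2 i, (i < n)%N & rho i = y.
  move=> yn; have [yr|ry] := ltnP (y + r) e.
    exists (y + r + n - e)%N; first by lia.
    by rewrite /rho (_ : y + r + n - e + n - r + e = y + n + n)%N ?modnDr ?modn_small; lia.
  have [yr|{}yr] := ltnP (y + r - e) n.
    exists (y + r - e)%N => //.
    by rewrite /rho (_ : y + r - e + n - r + e = y + n)%N ?modnDr ?modn_small; lia.
  exists (y + r - e - n)%N; first by lia.
  by rewrite /rho (_ : y + r - e - n + n - r + e = y)%N ?modn_small; lia.
have rho_r : rho r = e.
  by rewrite /rho (_ : r + n - r + e = e + n)%N ?modnDr ?modn_small; lia.
apply: (@exists_2H_double n _ 7 (2 * j) (2 * j) (bumped7 n r h c K P Q) B); rewrite ?vE; try lia.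
- by [].
- exact: pairs_offsets.
- move=> i _; have -> : (4 * q)%N%:Z = 2 * h by rewrite /h; lia.
  by apply: row_sum_bumped7; rewrite (_ : _ - _ = 0) ?dvdz0 // /P /Q; lia.
- move=> i ltin; have -> : (4 * q)%N%:Z = 2 * h by rewrite /h; lia.
  by apply: col_sum_bumped7; lia.
- by move=> i _; exact: row_sum_pairs.
set v := (4 * q)%N => y y0 yv.
rewrite !count_class_cons count_class_nil /= (@slot_count_shift n v 2 P)
  (@slot_count_shift n v 2 Q).
set a := (X in (slot_count _ _ (bump _ _ X) _ + _ + _)%N).
set b := (X in (_ + (slot_count _ _ (bump _ _ X) _ + _) + _)%N).
have at_ f i : (i < n)%N -> same_class v (f i) y -> (1 <= slot_count n v f y%:Z)%N.
  exact: slot_count_ge1.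
have at2 f i i' : (i < n)%N -> (i' < n)%N -> i != i' -> same_class v (f i) y ->
    same_class v (f i') y -> (2 <= slot_count n v f y%:Z)%N by exact: slot_count_ge2.
have r3 : (r + 3 = m)%N by rewrite /r /m; lia.
have aS i : a i.+1 = (m + n)%N%:Z - u i by rewrite /a back1S /c /K; lia.
have a0 : a 0%N = (m + n)%N%:Z - u (2 * m)%N.
  by rewrite /a (_ : back n 1 0 = 2 * m)%N /c /K /back /=; lia.
have bO i : b (2 * i).+1 = (2 * i).+1%:Z - m%:Z.
  by rewrite /b back1S /c /K uE uO; lia.
have bE i : b (2 * i.+1)%N = (2 * i.+1)%N%:Z - m%:Z.
  by rewrite /b /c /K uE mulnS add2n back1S uO; lia.
have b0 : b 0%N = - m%:Z.
  have -> : (0 = 2 * 0)%N by [].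
  by rewrite /b (_ : back n 1 (2 * 0) = 2 * m)%N /c /K ?uE ?muln0 /back /=; lia.
have bi i : (i < n)%N -> b i = i%:Z - m%:Z.
  move=> ltin; have := odd_double_half i; case: (odd i) => /= iE.
    by rewrite -[in b i]iE -mul2n bO; lia.
  case: i ltin iE => [|i] ltin iE; first by rewrite b0 sub0r.
  by rewrite -[in b _]iE (_ : (0 + (i.+1)./2.*2 = 2 * (i.+1)./2.-1.+1)%N) ?bE; lia.
have am : a (r + 3)%N = x%:Z.
  rewrite r3 (_ : m = (2 * e.-1).+2)%N; last by rewrite /m; lia.
  by rewrite aS uO /x /n /m; lia.
have [y1|y1] := leqP y m.
  suff : (2 <= slot_count n v (bump (r + 3) h b) y%:Z)%N by lia.
  by apply: (at2 _ (m + y)%N (m - y)%N); rewrite ?bumpN ?bi /same_class; lia.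
have [y2|y2] := leqP y (m + n).
  have hc : (1 <= slot_count n v c y%:Z)%N.
    have [i ltin ui] := u_onto (y - m.+1)%N ltac:(lia).
    by apply: (at_ c i); rewrite // /c ui /same_class; lia.
  have [yx|yx] := eqVneq y x.
    suff : (1 <= slot_count n v (bump r h Q) y%:Z)%N by lia.
    by apply: (at_ _ r); rewrite ?bumpE /Q ?rho_r /h /same_class; lia.
  suff : (1 <= slot_count n v (bump (r + 3) h a) y%:Z)%N by lia.
  have [i ltin ai] : exists2 i, (i < n)%N & a i = y%:Z.
    have [i ltin ui] := u_onto (m + n - y)%N ltac:(lia).
    have [i2|i2] := ltnP i (2 * m); first by exists i.+1; rewrite ?aS ?ui; lia.
    exists 0%N; first by lia.
    by rewrite a0 (_ : 2 * m = i)%N ?ui; lia.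
  have i3 : i != (r + 3)%N.
    by apply: contraNneq yx => i3; move: ai; rewrite i3 am; lia.
  by apply: (at_ _ i); rewrite ?bumpN ?ai /same_class ?eqxx.
have [y3|y3] := leqP y (m + n + w).
  suff : (1 <= count_class n v B y%:Z)%N by lia.
  by apply: count_class_pairs; lia.
have [y4|y4] := leqP y (m + n + w + n).
  have [i ltin ri] := rhoP (y - (m + n + w + 1))%N ltac:(lia).
  have : (1 <= slot_count n v P y%:Z)%N.
    by apply: (at_ P i); rewrite // /P ri /same_class; lia.
  suff : (1 <= slot_count n v (bump r h P) y%:Z)%N by lia.
  apply: (at_ _ i) => //; rewrite /bump; case: eqP => [ir|_].
    by move: ri; rewrite ir /P rho_r /h /same_class; lia.
  by rewrite /P ri /same_class; lia.
have [y5|y5] := leqP y (m + 2 * n + w + w).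
  suff : (1 <= count_class n v B y%:Z)%N by lia.
  by apply: count_class_pairs; lia.
have [y6|y6] := ltnP y (2 * q).
  have [i ltin ri] := rhoP (y - (m + 2 * n + 2 * w + 1))%N ltac:(lia).
  have : (1 <= slot_count n v Q y%:Z)%N.
    by apply: (at_ Q i); rewrite // /Q ri /same_class; lia.
  have [ir|ir] := eqVneq i r.
    suff : (1 <= slot_count n v (bump (r + 3) h a) y%:Z)%N by lia.
    apply: (at_ _ (r + 3)%N); first by lia.
    by move: ri; rewrite bumpE am ir rho_r /h /same_class; lia.
  suff : (1 <= slot_count n v (bump r h Q) y%:Z)%N by lia.
  by apply: (at_ _ i); rewrite ?bumpN // /Q ri /same_class; lia.
suff : (2 <= slot_count n v (bump (r + 3) h b) y%:Z)%N by lia.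
apply: (@slot_count_half _ _ _ _ (r + 3)%N); try lia.
by rewrite bumpE bi /same_class /h; lia.
Qed.

(** * Necessary conditions *)

Lemma is_LH_pm_mult (n k : nat) (A : parray n n (hv 2 1 n k)) (x : 'Z_(hv 2 1 n k)) :
  (0 < n)%N -> (0 < k)%N -> is_LH k A -> pm_mult A x = (if x == 0%R then 0 else 2)%N.
Proof.
move=> n0 k0 [_ _ -> _ _]; rewrite /inJ divn1.
have v1 : (1 < hv 2 1 n k)%N by rewrite /hv -mulnA mulKn // addn1 ltnS muln_gt0 n0.
have vE : (Zp_trunc (hv 2 1 n k)).+2 = hv 2 1 n k by exact: Zp_cast.
have x_lt : (x < hv 2 1 n k)%N by rewrite -[X in (_ < X)%N]vE.
rewrite -val_eqE /=; have [->|x0] := posnP x; first by rewrite dvdn0.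
by rewrite gtnNdvd.
Qed.

Lemma exists_2H_k_neq2 n : (1 < n)%N -> ~ exists_2H n 2.
Proof.
move=> n1 [_ _ _ _ [A LA]]; have n0 : (0 < n)%N by lia.
have pmA x : pm_mult A x = (if x == 0%R then 0 else 2)%N by exact: is_LH_pm_mult.
have [rowA colA _ rsum csum] := LA.
pose i0 : 'I_n := Ordinal n0.
have /cards2P[j1 [j2 [j12 rowE]]] : #|[set j | A i0 j != None]| == 2%N by rewrite rowA.
have in_row j : (A i0 j != None) = (j \in [set j1; j2]) by rewrite -rowE inE.
case E1 : (A i0 j1) (in_row j1) => [a|]; last by rewrite !inE !eqxx.
case E2 : (A i0 j2) (in_row j2) => [b|]; last by rewrite !inE !eqxx orbT.
move=> _ _; have bE : b = - a.
  have := rsum i0; rewrite (bigD1 j1) //= (bigD1 j2) /=; last by rewrite eq_sym.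
  rewrite big1 ?addr0 => [|j /andP[jj1 jj2]].
    by rewrite E1 E2 /= => /eqP; rewrite addrC addr_eq0 => /eqP.
  by have := in_row j; rewrite !inE (negbTE jj1) (negbTE jj2); case: (A i0 j).
have /cards2P[i1 [i2 [i12 colE]]] : #|[set i | A i j1 != None]| == 2%N by rewrite colA.
have in_col i : (A i j1 != None) = (i \in [set i1; i2]) by rewrite -colE inE.
have [i' i'0 i'E] : exists2 i', i' != i0 & [set i1; i2] = [set i0; i'].
  have : i0 \in [set i1; i2] by rewrite -in_col E1.
  rewrite !inE => /orP[]/eqP i0E; last by exists i1; rewrite ?i0E // setUC.
  by exists i2; rewrite ?i0E // eq_sym.
case E3 : (A i' j1) (in_col i') => [c|]; last by rewrite i'E !inE !eqxx orbT.
move=> _; have cE : c = - a.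
  have := csum j1; rewrite (bigD1 i0) //= (bigD1 i') //=.
  rewrite big1 ?addr0 => [|i /andP[ii0 ii']].
    by rewrite E1 E3 /= => /eqP; rewrite addrC addr_eq0 => /eqP.
  by have := in_col i; rewrite i'E !inE (negbTE ii0) (negbTE ii'); case: (A i j1).
have : (3 <= pm_mult A a)%N; last by rewrite pmA; case: ifP.
(* The cell [(i0, j1)] counts for [a], the cells [(i0, j2)] and [(i', j1)] for [-a]. *)
rewrite /pm_mult -[3%N]/(1 + 2)%N leq_add //.
  by apply/card_gt0P; exists (i0, j1); rewrite inE /= E1.
have two : #|[set (i0, j2); (i', j1)]| = 2%N.
  by rewrite cards2 xpair_eqE [i0 == _]eq_sym (negbTE i'0).
rewrite -[X in (X <= _)%N]two; apply/subset_leq_card/subsetP => -[i j]; rewrite !inE !xpair_eqE.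
by case/orP => /andP[/eqP-> /eqP->] /=; rewrite ?E2 ?E3 ?bE ?cE.
Qed.

Lemma exists_2H_mod4_neq1 n k : exists_2H n k -> (n * k %% 4 != 1)%N.
Proof.
move=> [_ _ _ _ [A LA]]; apply/eqP => nk1.
have n0 : (0 < n)%N by case: (n) nk1.
have k0 : (0 < k)%N by case: (k) nk1; rewrite ?muln0.
have pmA x : pm_mult A x = (if x == 0%R then 0 else 2)%N by exact: is_LH_pm_mult.
have [_ _ _ rsum _] := LA.
have vE : hv 2 1 n k = (n * k).+1 by rewrite /hv -mulnA mulKn // addn1.
move: A LA pmA rsum; set v := hv 2 1 n k in vE * => A LA pmA rsum.
have v1 : (1 < v)%N by rewrite vE; case: (n * k)%N nk1.
have vt : (Zp_trunc v).+2 = v by exact: Zp_cast.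
have v4 : (v %% 4 = 2)%N by rewrite vE; lia.
(* Since [v] is even, negation preserves the parity of representatives. *)
have oddN (x : 'Z_v) : odd (- x : 'Z_v)%R = odd x.
  have x_lt : (x < v)%N by rewrite -[X in (_ < X)%N]vt.
  have [->|x0] := eqVneq x 0; first by rewrite oppr0.
  have {}x0 : (0 < x)%N by rewrite lt0n.
  have -> : (- x : 'Z_v)%R = (v - x)%N :> nat by rewrite /= modn_small; lia.
  lia.
(* [S] adds the representatives of the entries, [W] counts the odd ones; empty cells have [pval]
   equal to [0] and contribute to neither. *)
pose S := (\sum_i \sum_j (pval (A i j) : nat))%N.
pose W := (\sum_i \sum_j odd (pval (A i j)))%N.
have S_dvd : (v %| S)%N.
  have : ((S%:Z)%:~R : 'Z_v) == 0; last by rewrite intr_Zp_eq0.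
  rewrite -pmulrn /S natr_sum big1 // => i _; rewrite natr_sum -[RHS](rsum i).
  by apply: eq_bigr => j _; rewrite natr_Zp.
have SW : odd S = odd W.
  rewrite /S /W; elim/big_rec2: _ => // i s w _; rewrite !oddD => ->; congr (_ (+) _).
  by elim/big_rec2: _ => // j s' w' _; rewrite !oddD => ->; rewrite oddb.
have cell (c : option 'Z_v) : (2 * odd (pval c) =
    \sum_(x : 'Z_v) odd x * ((c == Some x) + (c == Some (- x))))%N.
  case: c => [a|]; last by rewrite big1 // => x _; rewrite muln0.
  have one (b : 'Z_v) : (\sum_(x : 'Z_v) odd x * (b == x) = odd b)%N.
    rewrite (bigD1 b) //= eqxx muln1 big1 ?addn0 // => x.
    by rewrite eq_sym => /negbTE->; rewrite muln0.
  under eq_bigr do rewrite mulnDr.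
  rewrite big_split /= [X in (_ + X)%N](reindex_inj oppr_inj) /=.
  under [X in (_ + X)%N]eq_bigr do rewrite opprK oddN.
  by rewrite !one mul2n addnn.
(* Double counting by cells and by elements: each of the [v / 2] odd elements has multiplicity two,
   so [W = v / 2], which is odd, although [S] is a multiple of the even [v]. *)
have W2 : (2 * W = \sum_(x : 'Z_v) odd x * pm_mult A x)%N.
  rewrite /W big_distrr /=; under eq_bigr do rewrite big_distrr /=.
  under eq_bigr do under eq_bigr => j _ do rewrite cell.
  under eq_bigr do rewrite exchange_big /=.
  rewrite exchange_big; apply: eq_bigr => x _; rewrite pm_multE big_distrr /=.
  by apply: eq_bigr => i _; rewrite big_distrr.
have sum_odd m : (\sum_(x < m) odd x = m./2)%N.
  by elim: m => [|m IH]; rewrite ?big_ord0 // big_ord_recr /= IH uphalf_half addnC.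
have WE : (2 * W = 2 * v./2)%N.
  rewrite W2 (_ : v./2 = \sum_(x : 'Z_v) odd x)%N; last by rewrite sum_odd vt.
  rewrite big_distrr /=; apply: eq_bigr => x _.
  by rewrite pmA; case: eqP => [->|_]; rewrite ?muln0 // mulnC.
have : odd v = false by lia.
have := dvdn_odd S_dvd.
lia.
Qed.

(** * Assembly by the residues of [n] and [k] modulo 4 *)

Theorem theorem4 (n k : nat) (hk : (2 <= k)%N) (hnk : (k <= n)%N) :
  exists_2H n k <-> (3 <= k)%N /\ (n * k %% 4 != 1)%N.
Proof.
split=> [ex|[k3 nk]].
  split; last exact: exists_2H_mod4_neq1 ex.
  rewrite ltn_neqAle hk andbT; apply/eqP => k2; rewrite -k2 in ex hnk.
  exact: exists_2H_k_neq2 hnk ex.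
move: (ltn_pmod k (isT : 0 < 4)%N) (ltn_pmod n (isT : 0 < 4)%N) nk.
rewrite -modnMm; move: (divn_eq k 4) (divn_eq n 4).
move: (k %/ 4)%N (n %/ 4)%N (k %% 4)%N (n %% 4)%N => j r k4 n4.
(* For odd [k] one residue of [n], the one equal to that of [k], makes the product [1] modulo [4]
   and is excluded. As [k >= 3], the residues [1] and [2] of [k] force [j > 0], whence the
   predecessors of [j]. *)
case: k4 => [|[|[|[|//]]]] kE nE _ n_lt.
- by move=> _; rewrite (_ : k = 4 * j)%N; [apply: exists_2H_k0 | ]; lia.
- rewrite (_ : k = 5 + 4 * j.-1)%N; last by lia.
  case: n4 nE n_lt => [|[|[|[|//]]]] nE _ //= _.
  + by rewrite (_ : n = 2 * (2 * r))%N; [apply: exists_2H_even_k1 | ]; lia.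
  + by rewrite (_ : n = 2 * (2 * r).+1)%N; [apply: exists_2H_even_k1 | ]; lia.
  + by rewrite (_ : n = 4 * r + 3)%N; [apply: exists_2H_n3_k1 | ]; lia.
- by move=> _; rewrite (_ : k = 6 + 4 * j.-1)%N; [apply: exists_2H_k2 | ]; lia.
- case: n4 nE n_lt => [|[|[|[|//]]]] nE _ //= _.
  + rewrite (_ : k = 3 + 4 * j)%N; last by lia.
    by rewrite (_ : n = 4 * r)%N; [apply: exists_2H_n0_k3 | ]; lia.
  + rewrite (_ : n = 4 * r + 1)%N; last by lia.
    have [j0|j0] := posnP j.
      by rewrite (_ : k = 3)%N; [apply: exists_2H_n1_k_eq3 | ]; lia.
    by rewrite (_ : k = 7 + 4 * j.-1)%N; [apply: exists_2H_n1_k3 | ]; lia.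
  + rewrite (_ : k = 3 + 4 * j)%N; last by lia.
    by rewrite (_ : n = 4 * r + 2)%N; [apply: exists_2H_n2_k3 | ]; lia.
Qed.
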